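(* Let $r\ge 2$ be a prime, let $d\ge 1$ be an integer, and set $N:=(r-1)(d+1)$. Let $\Delta_N$ be an $N$-dimensional simplex whose vertex set $\mathcal{C}$ (with $N+1$ elements) is partitioned into $d+2$ parts $\mathcal{C}=C_0\uplus\dots\uplus C_d\uplus C_{d+1}$ with $|C_i|=r-1$ for $i\le d$ and $|C_{d+1}|=1$. Then for every continuous map $f:\Delta_N\to\mathbb{R}^d$ there are $r$ pairwise disjoint faces $F_1,\dots,F_r$ of $\Delta_N$ such that (A) $|C_i\cap F_j|\le 1$ for every $i\in\{0,\dots,d+1\}$ and $j\in\{1,\dots,r\}$, and (B) $f(F_1)\cap\dots\cap f(F_r)\neq\emptyset$.
   Context: Here $|C_i\cap F_j|$ denotes the number of vertices of the face $F_j$ that belong to $C_i$. Faces are disjoint if they have no common vertex. *)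

(* Defs.v *)
From mathcomp Require Import all_boot all_order all_algebra.
From mathcomp Require Import all_classical all_reals all_analysis.

Set Implicit Arguments.
Unset Strict Implicit.
Unset Printing Implicit Defensive.

Import Order.TTheory GRing.Theory Num.Theory.

Local Open Scope ring_scope.

Definition affinely_independent (R : realType) (n m : nat)
    (v : 'I_n -> 'rV[R]_m) : Prop :=
  forall a : 'I_n -> R,
    \sum_i a i = 0 -> \sum_i a i *: v i = 0 -> forall i, a i = 0.

(* A face of the simplex with vertices v is encoded by the set F of (indices
   of) its vertices; [face v F] is the corresponding point set, the convex hull
   of the v i with i \in F. It is empty for F = set0. *)
Definition face (R : realType) (n m : nat) (v : 'I_n -> 'rV[R]_m)
    (F : {set 'I_n}) : set 'rV[R]_m :=
  [set x | exists w : 'I_n -> R,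
     [/\ forall i, 0 <= w i,
         forall i, i \notin F -> w i = 0,
         \sum_i w i = 1 &
         x = \sum_i w i *: v i]]%classic.

Definition simplex (R : realType) (n m : nat) (v : 'I_n -> 'rV[R]_m) :
    set 'rV[R]_m :=
  face v [set: 'I_n]%SET.

(* Main.v *)
Require Import Defs.
From mathcomp Require Import all_boot all_order all_algebra.
From mathcomp Require Import boolp.

Set Implicit Arguments.
Unset Strict Implicit.
Unset Printing Implicit Defensive.

Import Order.TTheory GRing.Theory Num.Theory.

Local Open Scope ring_scope.

(** A point of the join of [d+1] chessboard complexes [(r-1) x r] with [r]
    points distributes weights over pairs (vertex [x], column [j]); its [j]-th
    column is a point of a face [F_j] meeting each [C_i] at most once, and faces
    of distinct columns are disjoint.  If the theorem failed, the masses [t_j]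
    of the columns and the points [f(x_j)] would never coincide for all [j], and
    recording a coordinate in which they differ together with a column where
    that coordinate is maximal would label the points equivariantly under the
    shift of columns by ['F_r].  By compactness a small enough tuple never
    carries all labels [(k, j)], [j : 'F_r], for any [k]: its labels lie in a
    free [r]-shift complex [L] of dimension one less than that of the join.

    Such a labelling is excluded as in Dold's theorem, with coefficients in
    ['F_r].  Write [g] for the shift and [N] for the sum of its powers.  Since
    the action on [L] is free, there are alternating cochains [s_0 = 1, s_1, ...]
    on [L] with [d s_i = (1 - g) s_(i+1)] or [d s_i = N s_(i+1)] alternately, and
    the last one is closed for lack of simplices.  Pulled back along iterated
    barycentric subdivision they satisfy the same relations on the join.  Pairing
    with the fundamental cycles of the chessboards, one block at a time,
    telescopes these relations to [s_0 = 0]: the last cochain vanishes on the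
    whole cycle because the cycle is a boundary (cone over the extra vertex),
    and within one block the transfer from the simplex on the [r] columns to
    the chessboard multiplies boundaries by factors prime to [r]. *)

(** * Cochains on tuples *)

Section Cochains.
Variables (K : nzRingType) (T : eqType).
Implicit Types (f g : seq T -> K) (s t u : seq T) (x y : T).

(* The value of [f] on the simplicial boundary of the ordered tuple [t]; the
   empty tuple is a simplex of dimension -1, so everything is augmented. *)
Fixpoint cobd f t : K :=
  if t is x :: t' then f t' - cobd (fun u => f (x :: u)) t' else 0.

Lemma eq_in_cobd f g t :
  (forall u, subseq u t -> (size u).+1 = size t -> f u = g u) ->
  cobd f t = cobd g t.
Proof.
elim: t f g => //= x t IH f g fg.
have -> : f t = g t by apply: fg => //; apply: subseq_cons.
congr (_ - _); apply: IH => u ut su.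
by apply: fg; rewrite /= ?eqxx ?su.
Qed.

Lemma eq_cobd f g t : f =1 g -> cobd f t = cobd g t.
Proof. by move=> fg; apply: eq_in_cobd => u _ _; apply: fg. Qed.

Lemma cobd0 t : cobd (fun=> 0) t = 0.
Proof. by elim: t => //= _ t ->; rewrite subrr. Qed.

Lemma cobdB f g t : cobd (fun u => f u - g u) t = cobd f t - cobd g t.
Proof.
elim: t f g => /= [|x t IH] f g; first by rewrite subrr.
by rewrite IH !opprD !opprK addrACA.
Qed.

Lemma cobdN f t : cobd (fun u => - f u) t = - cobd f t.
Proof.
by elim: t f => /= [|x t IH] f; rewrite ?oppr0 // IH opprB opprK addrC.
Qed.

Lemma cobd_sum (I : Type) (r : seq I) (P : pred I) (F : I -> seq T -> K) t :
  cobd (fun u => \sum_(i <- r | P i) F i u) t = \sum_(i <- r | P i) cobd (F i) t.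
Proof.
elim: t F => /= [|x t IH] F; first by rewrite big1.
by rewrite IH -sumrB.
Qed.

Lemma cobd_cobd f t : cobd (cobd f) t = 0.
Proof.
elim: t f => //= x t IH f.
by rewrite cobdB IH subr0 subrr.
Qed.

Lemma cobd_cat f t u :
  cobd f (t ++ u) = cobd (fun s => f (s ++ u)) t
                    + (-1) ^+ size t * cobd (fun s => f (t ++ s)) u.
Proof.
elim: t f => /= [|x t IH] f; first by rewrite add0r expr0 mul1r.
by rewrite IH opprD addrA exprS mulN1r mulNr.
Qed.

Definition skew_cochain f :=
  forall s x y t, f (s ++ x :: y :: t) = - f (s ++ y :: x :: t).

(** Vanishing on repeated entries is required separately because skew-symmetry does not force it in
    characteristic 2. *)
Definition alternating_cochain f :=
  skew_cochain f /\ forall s x t, f (s ++ x :: x :: t) = 0.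

Lemma skew_cons f x : skew_cochain f -> skew_cochain (fun u => f (x :: u)).
Proof. by move=> sf s; apply: (sf (x :: s)). Qed.

Lemma alternating_cons f x :
  alternating_cochain f -> alternating_cochain (fun u => f (x :: u)).
Proof.
case=> sf zf; split=> [|s y t]; first exact: skew_cons.
exact: (zf (x :: s)).
Qed.

Lemma skew_cobd f : skew_cochain f -> skew_cochain (cobd f).
Proof.
move=> sf s; elim: s f sf => [|z s IH] f sf x y t /=; last first.
  by rewrite (IH _ (skew_cons z sf)) (sf s) opprB opprK addrC.
rewrite (@eq_cobd (fun u => f (x :: y :: u)) (fun u => - f (y :: x :: u))).
  by rewrite cobdN !opprB addrA.
by move=> u; apply: (sf [::]).
Qed.

Lemma alternating_cobd f : alternating_cochain f -> alternating_cochain (cobd f).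
Proof.
move=> [sf zf]; split; first exact: skew_cobd.
move=> s; elim: s f sf zf => [|z s IH] f sf zf x t /=; last first.
  rewrite zf IH ?subrr //; first exact: skew_cons.
  by move=> s' y t'; apply: (zf (z :: s')).
rewrite (@eq_cobd (fun u => f (x :: x :: u)) (fun=> 0)) ?cobd0 ?subr0 ?subrr //.
by move=> u; apply: (zf [::]).
Qed.

Lemma skew_move f s x u t : skew_cochain f ->
  f (s ++ x :: u ++ t) = (-1) ^+ size u * f (s ++ u ++ x :: t).
Proof.
move=> sf; elim: u s => [|y u IH] s /=; first by rewrite expr0 mul1r.
by rewrite sf -cat_rcons IH exprS mulN1r mulNr cat_rcons.
Qed.

(** Moving an entry changes the value by a sign only, so vanishing survives reordering without
    tracking the sign of the permutation. *)
Lemma skew_perm f s t : skew_cochain f -> perm_eq s t -> f s = 0 -> f t = 0.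
Proof.
move=> sf; elim: t s f sf => [|x t IH] s f sf.
  by move=> /perm_nilP ->.
move=> pst; have : x \in s by rewrite (perm_mem pst) mem_head.
move=> /path.splitPr sp; case: sp pst => s1 s2 pst.
have pst' : perm_eq (s1 ++ s2) t.
  by rewrite -(perm_cons x) -(permPr pst) -cat1s perm_catCA.
move=> f0; apply: (IH _ (fun u => f (x :: u)) (skew_cons x sf) pst').
by rewrite (skew_move [::]) // f0 mulr0.
Qed.

Lemma alternating_nuniq f t : alternating_cochain f -> ~~ uniq t -> f t = 0.
Proof.
elim: t f => //= x t IH f af; rewrite negb_and negbK => /orP[|nt].
  case/splitPr => s u; rewrite (skew_move [::]); last by case: af.
  by case: af => _ /= ->; rewrite mulr0.
exact: (IH (fun u => f (x :: u)) (alternating_cons x af)).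
Qed.

End Cochains.

Lemma cobd_map (K : nzRingType) (T U : eqType) (h : T -> U) (f : seq U -> K) t :
  cobd (fun u => f (map h u)) t = cobd f (map h t).
Proof. by elim: t f => //= x t IH f; rewrite (IH (fun u => f (h x :: u))). Qed.

Lemma sum_F2 p (f : 'F_p -> 'F_p) : p = 2 -> \sum_a f a = f 0 - f 1.
Proof.
move=> p2; subst p; rewrite big_ord_recl big_ord_recl big_ord0 addr0.
have -> : lift ord0 ord0 = 1 :> 'F_2 by exact: val_inj.
by congr (_ + _); apply: val_inj; case: (f 1) => [[|[|m]]].
Qed.

(** * The operators 1 - g and N of a cyclic action *)

Section Operators.
Variable p : nat.
Let F := 'F_p.
Variables (T : eqType) (sh : F -> T -> T).
Hypothesis shD : forall a b x, sh a (sh b x) = sh (a + b) x.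
Hypothesis sh0 : forall x, sh 0 x = x.
Implicit Types (f g : seq T -> F).

Definition shift_diff f t := f t - f (map (sh 1) t).
Definition orbit_sum f t := \sum_(a : F) f (map (sh a) t).

(* The differentials of the minimal resolution of the cyclic group: consecutive
   ones compose to zero. *)
Definition res_op i f :=
  if i is i'.+1 then if odd i then shift_diff f else orbit_sum f else f.

Lemma map_shD a b t : map (sh a) (map (sh b) t) = map (sh (a + b)) t.
Proof. by rewrite -map_comp; apply: eq_map => x /=; rewrite shD. Qed.

Lemma map_sh0 t : map (sh 0) t = t.
Proof. by rewrite (eq_map sh0) map_id. Qed.

Lemma eq_res_op i f g t :
  (forall a, f (map (sh a) t) = g (map (sh a) t)) -> f t = g t ->
  res_op i f t = res_op i g t.
Proof.
move=> fg fg0; case: i => [//|i] /=; case: ifP => _.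
  by rewrite /shift_diff fg0 fg.
by apply: eq_bigr => a _; apply: fg.
Qed.

Lemma cobd_res_op i f t : cobd (res_op i f) t = res_op i (cobd f) t.
Proof.
case: i => [//|i] /=; case: ifP => _.
  by rewrite /shift_diff cobdB cobd_map.
by rewrite /orbit_sum cobd_sum; apply: eq_bigr => a _; rewrite cobd_map.
Qed.

Lemma res_opB i f g t :
  res_op i (fun u => f u - g u) t = res_op i f t - res_op i g t.
Proof.
case: i => [//|i] /=; case: ifP => _.
  by rewrite /shift_diff !opprD !opprK addrACA.
by rewrite /orbit_sum sumrB.
Qed.

Lemma res_op_res_op i f t : res_op i.+1 (res_op i.+2 f) t = 0.
Proof.
have normS u : orbit_sum f (map (sh 1) u) = orbit_sum f u.
  rewrite /orbit_sum [RHS](reindex_inj (addIr 1)) /=; apply: eq_bigr => a _.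
  by rewrite map_shD.
rewrite /=; case: (odd i) => /=; last by rewrite /shift_diff normS subrr.
rewrite /orbit_sum /shift_diff sumrB.
rewrite [X in X - _](reindex_inj (addrI 1)) /= -sumrB big1 // => a _.
by rewrite map_shD subrr.
Qed.

(** For odd [p] the offset [p.-1 * k] is even and keeps the operator; for [p = 2] the two operators
    coincide, since -1 = 1. *)
Lemma res_op_parity i k f t : prime p -> res_op ((p.-1 * k) + i.+1) f t = res_op i.+1 f t.
Proof.
move=> pp; have [p2|op] := even_prime pp; last first.
  by rewrite addnS /= oddD oddM -subn1 oddB ?prime_gt0 // op.
have norm_oneminus : orbit_sum f t = shift_diff f t.
  by rewrite /orbit_sum sum_F2 // /shift_diff map_sh0.
rewrite addnS /=; case: ifP; case: ifP => //.
Qed.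

End Operators.

(** * The chessboard obstruction *)

Section ColumnSimplex.
Variable p : nat.
Local Notation F := 'F_p.
Implicit Types (f g : seq F -> F) (j : seq F).

Let sh (a x : F) := a + x.

Lemma colD a b x : sh a (sh b x) = sh (a + b) x.
Proof. by rewrite /sh addrA. Qed.

(* Pairing with the chain [c_i] of the full simplex on the columns, where
   [c_(i+1)] is the cone with apex 0 over [res_op i c_i]; as the simplex is
   acyclic, the boundary of [c_(i+1)] is [res_op i c_i]. *)
Fixpoint cone_chain i f : F :=
  if i is i'.+1 then cone_chain i' (res_op sh i' (fun u => f (0 :: u))) else f [::].

Lemma eq_cone_chain i f g :
  (forall u, size u = i -> f u = g u) -> cone_chain i f = cone_chain i g.
Proof.
elim: i f g => [|i IH] f g fg /=; first exact: fg.
by apply: IH => u su; apply: eq_res_op => [a|]; apply: fg; rewrite /= ?size_map su.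
Qed.

Lemma cone_chainB i f g :
  cone_chain i (fun u => f u - g u) = cone_chain i f - cone_chain i g.
Proof.
elim: i f g => [//|i IH] f g /=; rewrite -IH.
by apply: eq_cone_chain => u _; rewrite res_opB.
Qed.

Lemma cone_chain0 i : cone_chain i (fun=> 0) = 0.
Proof.
rewrite -[RHS](subrr (cone_chain i (fun=> 0))) -cone_chainB.
by apply: eq_cone_chain => u _; rewrite subrr.
Qed.

Lemma cone_chainMn i f k : cone_chain i (fun u => f u *+ k) = cone_chain i f *+ k.
Proof.
elim: k => [|k IH]; first by rewrite mulr0n cone_chain0.
rewrite mulrS -IH -[cone_chain i f]opprK -[- cone_chain i f]sub0r -(cone_chain0 i) -cone_chainB.
rewrite addrC -cone_chainB; apply: eq_cone_chain => u _.
by rewrite sub0r opprK mulrSr.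
Qed.

(** The boundary of a cone over z is z minus the cone over the boundary of z. Here z is [res_op i]
    of the previous chain, and its boundary vanishes because consecutive operators compose to
    zero. *)
Lemma cone_chain_cobd i f : cone_chain i.+1 (cobd f) = cone_chain i (res_op sh i f).
Proof.
elim: i f => [|i IH] f; first by rewrite /= subr0.
have -> : cone_chain i.+2 (cobd f) = cone_chain i.+1 (res_op sh i.+1 f)
    - cone_chain i.+1 (res_op sh i.+1 (cobd (fun u => f (0 :: u)))).
  rewrite -cone_chainB.
  apply: (@eq_cone_chain i.+1 (res_op sh i.+1 (fun u => cobd f (0 :: u)))) => u _.
  by rewrite -res_opB.
set h := fun u => _; suff -> : cone_chain i.+1 (res_op sh i.+1 (cobd h)) = 0.
  by rewrite subr0.
rewrite (@eq_cone_chain _ _ (cobd (res_op sh i.+1 h))); last first.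
  by move=> u _; rewrite cobd_res_op.
rewrite IH -[RHS](cone_chain0 i); apply: eq_cone_chain => u su.
(* [res_op 0] is the identity and not part of the alternation; in that degree 1 - g vanishes because
   shifts fix the empty tuple. *)
case: i {IH} su => [/size0nil->|i _]; first by rewrite /= /shift_diff subrr.
exact: (res_op_res_op colD).
Qed.

(** Descending induction on the degree: pairing with the cone chains turns the coboundary of [f m]
    into [res_op m (f m)], and the unit [c m] cancels. In degree 0 what remains is [f 0 [::]]. *)
Lemma cone_telescope n (f : nat -> seq F -> F) (c : nat -> nat) :
  (forall i, (i < n)%N -> (c i)%:R != 0 :> F) ->
  (forall i j, (i < n)%N -> size j = i.+1 ->
     cobd (f i) j *+ c i = res_op sh i.+1 (f i.+1) j) ->
  (forall j, size j = n.+1 -> cobd (f n) j = 0) ->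
  f 0 [::] = 0.
Proof.
move=> c0 rel top.
suff H k : (k <= n)%N -> cone_chain (n - k) (res_op sh (n - k) (f (n - k)%N)) = 0.
  by have := H n (leqnn n); rewrite subnn.
elim: k => [|k IH] kn.
  by rewrite subn0 -cone_chain_cobd -(cone_chain0 n.+1); apply: eq_cone_chain.
have := IH (ltnW kn); rewrite -{1 2 3}(subnSK kn); set m := (n - k.+1)%N => H.
have mn : (m < n)%N by rewrite /m subnS prednK ?leq_subr // subn_gt0.
apply/eqP; rewrite -(mulIr_eq0 _ (mulIf (c0 m mn))) mulr_natr -cone_chain_cobd.
rewrite -cone_chainMn -H; apply/eqP/eq_cone_chain => u su.
exact: rel.
Qed.

End ColumnSimplex.

(** * Rook placements and the transfer to the chessboard *)

Section Placements.
Variables (p : nat) (X : finType).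
Local Notation F := 'F_p.
Implicit Types (f g : seq (X * F) -> F) (j : seq F) (A C : {set X}).

Definition cell_shift (a : F) (x : X * F) := (x.1, a + x.2).
Local Notation sh := cell_shift.

Lemma cell_shiftD a b x : sh a (sh b x) = sh (a + b) x.
Proof. by rewrite /sh /= addrA. Qed.

(* The sum of [f] over all ways to place rooks in distinct rows of [A] and in
   the successive columns [j]: the transfer from simplices on columns to the
   chessboard complex. *)
Fixpoint placement_sum A j f : F :=
  if j is y :: j' then \sum_(x in A) placement_sum (A :\ x) j' (fun u => f ((x, y) :: u))
  else f [::].

Lemma eq_placement_sum A j f g :
  (forall u, unzip2 u = j -> uniq (unzip1 u) -> all (mem A) (unzip1 u) ->
     f u = g u) -> placement_sum A j f = placement_sum A j g.
Proof.
elim: j A f g => [|y j IH] A f g fg /=; first exact: fg.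
apply: eq_bigr => x xA; apply: IH => u uj uu uA; apply: fg => /=.
- by rewrite uj.
- rewrite uu andbT; apply/negP => /(allP uA) /=.
  by rewrite !inE eqxx.
- rewrite xA; apply: sub_all uA => z /=.
  by rewrite !inE => /andP[].
Qed.

Lemma placement_sumB A j f g :
  placement_sum A j (fun u => f u - g u) = placement_sum A j f - placement_sum A j g.
Proof.
elim: j A f g => //= y j IH A f g; rewrite -sumrB.
by apply: eq_bigr => x _; rewrite IH.
Qed.

Lemma placement_sum_sum A j (I : finType) (G : I -> seq (X * F) -> F) :
  placement_sum A j (fun u => \sum_i G i u) = \sum_i placement_sum A j (G i).
Proof.
elim: j A G => //= y j IH A G; rewrite exchange_big.
by apply: eq_bigr => x _; rewrite IH.
Qed.

Lemma placement_sum_shift A j a f :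
  placement_sum A j (fun u => f (map (sh a) u)) = placement_sum A (map (+%R a) j) f.
Proof.
elim: j A f => //= y j IH A f; apply: eq_bigr => x _.
exact: (IH _ (fun u => f ((x, a + y) :: u))).
Qed.

Lemma placement_sum_res_op A j i f :
  placement_sum A j (res_op sh i f) = res_op +%R i (fun j => placement_sum A j f) j.
Proof.
case: i => [//|i] /=; case: ifP => _.
  by rewrite /shift_diff placement_sumB placement_sum_shift.
by rewrite /orbit_sum placement_sum_sum; apply: eq_bigr => a _; rewrite placement_sum_shift.
Qed.

Lemma exchange_setD1 A (G : X -> X -> F) :
  \sum_(x in A) \sum_(y in A :\ x) G x y = \sum_(y in A) \sum_(x in A :\ y) G x y.
Proof.
rewrite (exchange_big_dep (mem A)) /=; last by move=> x y _; rewrite !inE => /andP[].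
apply: eq_bigr => y yA; apply: eq_bigl => x.
by rewrite !inE yA andbT eq_sym andbC.
Qed.

(** A placement along [j] leaves [#|A| - size j] rows of [A] free, and is counted once for each of
    them. *)
Lemma placement_sum_setD1 A j f :
  \sum_(x in A) placement_sum (A :\ x) j f = placement_sum A j f *+ (#|A| - size j).
Proof.
elim: j A f => [|z j IH] A f /=; first by rewrite sumr_const subn0.
rewrite exchange_setD1 -sumrMnl; apply: eq_bigr => y yA.
under eq_bigr => x _ do rewrite setDDl setUC -setDDl.
rewrite IH; congr (_ *+ _).
by rewrite (cardsD1 y A) yA.
Qed.

(** Renaming the two rows turns an exchange of columns into an exchange of adjacent entries of
    [f]. *)
Lemma skew_placement_sum A f : skew_cochain f -> skew_cochain (fun j => placement_sum A j f).
Proof.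
move=> sf s; elim: s A f sf => [|z s IH] A f sf x y t /=.
  rewrite [LHS]exchange_setD1 -sumrN; apply: eq_bigr => a _.
  rewrite -sumrN; apply: eq_bigr => b _.
  rewrite [A :\ a :\ b]setDDl setUC -setDDl.
  have -> : placement_sum (A :\ b :\ a) t (fun u => f [:: (b, x), (a, y) & u]) =
            placement_sum (A :\ b :\ a) t (fun u => 0 - f [:: (a, y), (b, x) & u]).
    by apply: eq_placement_sum => u _ _ _; rewrite sub0r; apply: (sf [::]).
  rewrite placement_sumB.
  rewrite (_ : placement_sum _ _ (fun=> 0) = 0) ?sub0r //.
  by rewrite -[RHS](subrr (placement_sum (A :\ b :\ a) t (fun=> 0))) -placement_sumB;
     apply: eq_placement_sum => u _ _ _; rewrite subrr.
rewrite -sumrN; apply: eq_bigr => a _; rewrite IH //.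
exact: skew_cons.
Qed.

(** Removing one rook from the placements along [j] yields each placement along the remaining
    columns once for every row it leaves free, that is [#|A|.+1 - size j] times. *)
Lemma placement_sum_cobd A j f :
  placement_sum A j (cobd f) = cobd (fun i => placement_sum A i f) j *+ (#|A|.+1 - size j).
Proof.
elim: j A f => [|y j IH] A f; first by rewrite mul0rn.
rewrite [placement_sum _ _ _]/= [size _]/= [cobd _ (_ :: _)]/= subSS mulrnBl -placement_sum_setD1.
rewrite cobd_sum -sumrMnl -sumrB; apply: eq_bigr => x xA.
by rewrite placement_sumB IH [#|A|](cardsD1 x) xA.
Qed.

End Placements.

(** * Pairing with the join of chessboard cycles *)

Section Pairing.
Variables (p : nat) (p_prime : prime p) (X : finType).
Local Notation F := 'F_p.
Local Notation sh := (@cell_shift p X).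
Implicit Types (f g : seq (X * F) -> F) (j : seq F) (C : {set X}) (Cs : seq {set X}).

Definition columns : seq F := [seq i%:R | i <- iota 0 p].

Lemma size_columns : size columns = p.
Proof. by rewrite size_map size_iota. Qed.

Lemma columns_uniq : uniq columns.
Proof.
rewrite map_inj_in_uniq ?iota_uniq // => i k.
rewrite !mem_iota /= !add0n => ip kp /(congr1 val); rewrite /= !val_Fp_nat //.
by rewrite !modn_small.
Qed.

Lemma perm_columns j : uniq j -> size j = p -> perm_eq columns j.
Proof.
move=> uj sj; rewrite perm_sym; apply: uniq_perm => //; first exact: columns_uniq.
have sub : {subset j <= enum F} by move=> y; rewrite mem_enum.
have le : (size (enum F) <= size j)%N by rewrite -cardE card_Fp ?sj.
move=> x; have [_ ->] := uniq_min_size uj sub le.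
rewrite mem_enum; apply/esym/mapP; exists (val x).
  rewrite mem_iota /= add0n -[X in (_ < X)%N](Fp_cast p_prime).
  exact: ltn_ord.
by rewrite natr_Zp.
Qed.

Lemma expN1p : (-1) ^+ p.-1 = 1 :> F.
Proof.
have [p2|op] := even_prime p_prime; last first.
  by rewrite -signr_odd -subn1 oddB ?prime_gt0 // op.
rewrite p2; clear p_prime; subst p; exact: val_inj.
Qed.

(** The unit shift rotates the [p] columns cyclically, a permutation of sign [(-1) ^+ p.-1], which
    is 1 in ['F_p] also for [p = 2]. *)
Lemma skew_columns (f : seq F -> F) (a : F) :
  skew_cochain f -> f (map (+%R a) columns) = f columns.
Proof.
rewrite -[a]natr_Zp; elim: (val a) f => [|n IH] f sf.
  by rewrite (eq_map (@add0r _)) map_id.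
have -> : map (+%R n.+1%:R) columns = map (+%R n%:R) (map (+%R 1) columns).
  by rewrite -[RHS]map_comp; apply: eq_map => x /=; rewrite addrA -mulrSr.
transitivity (f (map (+%R n%:R) columns)); last exact: IH.
have E0 : iota 0 p = 0%N :: iota 1 p.-1.
  by rewrite -{1}(prednK (prime_gt0 p_prime)).
have E1 : iota 1 p = rcons (iota 1 p.-1) p.
  rewrite -{1}(prednK (prime_gt0 p_prime)) -[p.-1.+1]addn1 iotaD cats1.
  by rewrite add1n prednK ?prime_gt0.
have -> : map (+%R 1) columns = rcons (behead columns) 0.
  have -> : map (+%R 1) columns = [seq i%:R | i <- iota 1 p].
    rewrite /columns -map_comp (iotaDl 1 0) -map_comp.
    by apply: eq_map => i /=; rewrite natrD.
  by rewrite E1 /columns E0 map_rcons pchar_Fp_0.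
have -> : columns = 0 :: behead columns.
  by rewrite /columns E0.
rewrite /= map_rcons -cats1 addr0; set s := behead columns.
rewrite -{2}[map _ s]cats0 (@skew_move _ _ f [::]) // size_map.
rewrite size_behead size_columns expN1p mul1r //.
Qed.

(* The transfer of the boundary of the full simplex is the fundamental cycle of
   the chessboard complex, and [pairing] pairs with the join of these cycles. *)
Definition chessboard_cycle C f := cobd (fun j => placement_sum C j f) columns.

Fixpoint pairing Cs f : F :=
  if Cs is C :: Cs' then chessboard_cycle C (fun u => pairing Cs' (fun v => f (u ++ v)))
  else f [::].

(** A condition met by every tuple that [pairing Cs] evaluates; the lengths of the blocks are left
    open. *)
Fixpoint facet Cs (u : seq (X * F)) : Prop :=
  if Cs is C :: Cs' then
    exists s t : seq (X * F), [/\ u = s ++ t, uniq (unzip1 s) && uniq (unzip2 s),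
      {subset unzip1 s <= C} & facet Cs' t]
  else u = [::].

Lemma eq_pairing Cs f g :
  (forall u, facet Cs u -> f u = g u) -> pairing Cs f = pairing Cs g.
Proof.
elim: Cs f g => [|C Cs IH] f g fg /=; first exact: fg.
apply: eq_in_cobd => j jc _; apply: eq_placement_sum => u uj u1 uA; apply: IH => v fv.
apply: fg => /=; exists u, v; split => //; last exact/allP.
by rewrite u1 uj (subseq_uniq jc columns_uniq).
Qed.

Lemma pairingB Cs f g :
  pairing Cs (fun u => f u - g u) = pairing Cs f - pairing Cs g.
Proof.
elim: Cs f g => //= C Cs IH f g; rewrite /chessboard_cycle -cobdB.
apply: eq_cobd => j; rewrite -placement_sumB; apply: eq_placement_sum => u _ _ _.
exact: IH.
Qed.

Lemma pairing0 Cs : pairing Cs (fun=> 0) = 0.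
Proof.
rewrite -[RHS](subrr (pairing Cs (fun=> 0))) -pairingB.
by apply: eq_pairing => u _; rewrite subrr.
Qed.

Lemma pairing_sum Cs (I : finType) (G : I -> seq (X * F) -> F) :
  pairing Cs (fun u => \sum_i G i u) = \sum_i pairing Cs (G i).
Proof.
elim: Cs G => //= C Cs IH G; rewrite /chessboard_cycle -cobd_sum.
apply: eq_cobd => j; rewrite -placement_sum_sum; apply: eq_placement_sum => u _ _ _.
exact: IH.
Qed.

Lemma pairing_sign Cs n f :
  pairing Cs (fun u => (-1) ^+ n * f u) = (-1) ^+ n * pairing Cs f.
Proof.
rewrite -signr_odd; case: (odd n); rewrite ?expr0 ?expr1 ?mulN1r ?mul1r.
  rewrite -[RHS]sub0r -(pairing0 Cs) -pairingB.
  by apply: eq_pairing => u _; rewrite mulN1r sub0r.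
by apply: eq_pairing => u _; rewrite mul1r.
Qed.

Lemma pairing_cobd_cat Cs f t :
  pairing Cs (fun v => cobd (fun u => f (u ++ v)) t) =
  cobd (fun u => pairing Cs (fun v => f (u ++ v))) t.
Proof.
elim: t f => [|x t IH] f /=; first exact: pairing0.
by rewrite pairingB (IH (fun u => f (x :: u))).
Qed.

(** A join of cycles is a cycle. In the Leibniz rule [cobd_cat] the later blocks contribute nothing
    by induction; in the first block, on p - 1 columns, the factor of [placement_sum_cobd] is p - (p
    - 1) = 1, so a coboundary is applied twice. *)
Lemma pairing_cobd Cs f : all (fun C => #|C| == p.-1) Cs -> pairing Cs (cobd f) = 0.
Proof.
elim: Cs f => [//|C Cs IH] f /= /andP[/eqP cC aC].
set th := fun u => pairing Cs (fun v => f (u ++ v)).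
rewrite /chessboard_cycle (@eq_cobd _ _ _ (fun j => placement_sum C j (cobd th))); last first.
  move=> j; apply: eq_placement_sum => u _ _ _.
  rewrite /th -pairing_cobd_cat.
  transitivity (pairing Cs (fun v => cobd (fun s => f (s ++ v)) u
      - (-1) ^+ (size u).+1 * cobd (fun s => f (u ++ s)) v)).
    apply: eq_pairing => v _; rewrite cobd_cat exprS mulN1r mulNr opprK //.
  by rewrite pairingB pairing_sign IH // mulr0 subr0.
rewrite -[RHS](cobd_cobd (fun i => placement_sum C i th) columns).
apply: eq_in_cobd => j _ sj; rewrite placement_sum_cobd cC prednK ?prime_gt0 //.
suff -> : (p - size j = 1)%N by [].
by move: (size j) sj => n; rewrite size_columns => <-; rewrite subSnn.
Qed.

Lemma skew_pairing_cat Cs f :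
  skew_cochain f -> skew_cochain (fun u => pairing Cs (fun v => f (u ++ v))).
Proof.
move=> sf s x y t; rewrite -[RHS]sub0r -(pairing0 Cs) -pairingB.
by apply: eq_pairing => u _; rewrite sub0r -!catA sf.
Qed.

(** In each block the shift only rotates the columns of the cycle, which [skew_columns] absorbs. *)
Lemma pairing_shift Cs a f :
  skew_cochain f -> pairing Cs (fun u => f (map (sh a) u)) = pairing Cs f.
Proof.
elim: Cs f => [//|C Cs IH] f sf /=.
set th := fun u => pairing Cs (fun v => f (u ++ v)).
rewrite /chessboard_cycle -(@skew_columns (cobd (fun j => placement_sum C j th)) a); last first.
  exact/skew_cobd/skew_placement_sum/skew_pairing_cat.
rewrite -[RHS](cobd_map (+%R a) (fun j => placement_sum C j th)).
apply: eq_cobd => j; rewrite -placement_sum_shift.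
apply: eq_placement_sum => u _ _ _.
rewrite /th -[RHS](IH (fun v => f (map (sh a) u ++ v))); last first.
  by move=> s x y t; rewrite !catA sf.
by apply: eq_pairing => v _; rewrite map_cat.
Qed.

End Pairing.

(** * Descent through the blocks of the join *)

Section ChessboardObstruction.
Variables (p : nat) (p_prime : prime p) (X : finType) (I : eqType) (col : X -> I).
Local Notation F := 'F_p.
Local Notation sh := (@cell_shift p X).
Implicit Types (Cs : seq {set X}) (C : {set X}).

(** The edges of the join of the chessboard complexes, one complex for each color; its simplices are
    the pairwise compatible tuples. *)
Definition compatible : rel (X * F) := fun a b =>
  (a.1 != b.1) && ((col a.1 == col b.1) ==> (a.2 != b.2)).

Definition differently_colored : rel {set X} := fun C D =>
  [forall x in C, forall y in D, col x != col y].

Lemma placed_valid (s : seq (X * F)) :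
  uniq (unzip1 s) -> uniq (unzip2 s) -> pairwise compatible s.
Proof.
rewrite !uniq_pairwise !pairwise_map => u1 u2.
have := pairwise_relI (relpre fst [rel x y | x != y]) (relpre snd [rel x y | x != y]) s.
rewrite u1 u2 /=; apply: sub_pairwise => a b /= /andP[ab1 ab2].
by rewrite /compatible ab1 ab2 implybT.
Qed.

Lemma facet_valid Cs (u : seq (X * F)) :
  pairwise differently_colored Cs -> facet Cs u ->
  pairwise compatible u /\
  forall x, x \in u -> exists2 C, C \in Cs & x.1 \in C.
Proof.
elim: Cs u => [|C Cs IH] u /=; first by move=> _ ->.
move=> /andP[aC pC] [s [t [-> /andP[s1 s2] sC ft]]].
have [vt inC] := IH t pC ft; split; last first.
  move=> x; rewrite mem_cat => /orP[xs|/inC[D DC xD]].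
    by exists C; rewrite ?mem_head //; apply/sC/map_f.
  by exists D; rewrite // inE DC orbT.
rewrite pairwise_cat vt placed_valid // !andbT.
apply/allrelP => x y xs /inC[D DC yD].
have /forall_inP/(_ x.1 (sC _ (map_f _ xs)))/forall_inP/(_ _ yD) := allP aC _ DC.
move=> xy; rewrite /compatible (negPf xy) andbT.
by apply: contraNneq xy => ->.
Qed.

Variable tau : nat -> seq (X * F) -> F.
Variable n : nat.
Hypothesis swap_tau : forall i, skew_cochain (tau i).
Hypothesis cobd_tau : forall i t, (i < n)%N -> pairwise compatible t ->
  cobd (tau i) t = res_op sh i.+1 (tau i.+1) t.

(** Pairing off the blocks [Cs] and transferring [C] to its columns turns [tau] into cochains on the
    full simplex, where [cone_telescope] applies: its top condition is the vanishing assumed for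
    [C :: Cs], its conclusion the one claimed for [Cs]. *)
Lemma pairing_step C Cs : all (fun C => #|C| == p.-1) (C :: Cs) ->
  pairwise differently_colored (C :: Cs) -> (p.-1 * (size Cs).+1 <= n)%N ->
  pairing (C :: Cs) (tau (p.-1 * (size Cs).+1)) = 0 ->
  pairing Cs (tau (p.-1 * size Cs)) = 0.
Proof.
move=> cards unrel le_n top.
pose m := (p.-1 * size Cs)%N.
pose th i u := pairing Cs (fun v => tau (m + i) (u ++ v)).
(* Placements along a repeated column need not be compatible, so the relations for [tau] may fail
   there; cutting these tuples off makes [f i] alternating and the relations trivial on them. *)
pose f i (j : seq F) := if uniq j then placement_sum C j (th i) else 0.
have cC : #|C| = p.-1 by case/andP: cards => /eqP.
have th_swap i : skew_cochain (th i) by apply: skew_pairing_cat.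
have f_alt i : alternating_cochain (f i).
  split=> s x => [y t|t]; rewrite /f; last first.
    by rewrite cat_uniq /= mem_head /= !andbF.
  have -> : uniq (s ++ [:: x, y & t]) = uniq (s ++ [:: y, x & t]).
    by apply: perm_uniq; rewrite perm_cat2l (perm_catCA [:: x] [:: y]).
  by case: ifP => _; [apply: skew_placement_sum | rewrite oppr0].
have cobd_f i j : uniq j -> cobd (f i) j = cobd (fun j => placement_sum C j (th i)) j.
  by move=> uj; apply: eq_in_cobd => k kj _; rewrite /f (subseq_uniq kj uj).
have pp := prednK (prime_gt0 p_prime).
have -> : pairing Cs (tau m) = f 0%N [::] by rewrite /f /= /th addn0.
have sub1 i : (i < p.-1)%N -> (p.-1 - i < p)%N.
  by move=> ip; rewrite -[X in (_ < X)%N]pp ltnS leq_subr.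
apply: (@cone_telescope p p.-1 f (fun i => p.-1 - i)%N) => [i ip|i j ip sj|j sj].
(* The factors p - 1 - i with i < p - 1 lie strictly between 0 and p, hence are units modulo p. *)
- by rewrite -(dvdn_pcharf (pchar_Fp p_prime)) gtnNdvd ?subn_gt0 // sub1.
- have [uj|nuj] := boolP (uniq j); last first.
    rewrite (alternating_nuniq (alternating_cobd (f_alt i)) nuj) mul0rn.
    rewrite -[RHS](@eq_res_op p _ +%R i.+1 (fun=> 0) (f i.+1) j).
    + by rewrite /=; case: ifP => _; [rewrite /shift_diff subrr | rewrite /orbit_sum big1].
    + by move=> a; rewrite /f map_inj_uniq ?(negPf nuj) //; apply: addrI.
    + by rewrite /f (negPf nuj).
  rewrite cobd_f //.
  have -> : (p.-1 - i = #|C|.+1 - size j)%N by rewrite cC sj subSS.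
  rewrite -placement_sum_cobd.
  rewrite (@eq_res_op _ _ _ _ _ (fun j => placement_sum C j (th i.+1))); last first.
  + by rewrite /f uj.
  + by move=> a; rewrite /f map_inj_uniq ?uj //; apply: addrI.
  rewrite -placement_sum_res_op; apply: eq_placement_sum => u uj2 uu uC.
  rewrite {1}/th -pairing_cobd_cat //.
  transitivity (pairing Cs (fun v => cobd (tau (m + i)%N) (u ++ v))).
    transitivity (pairing Cs (fun v => cobd (tau (m + i)%N) (u ++ v)
        - (-1) ^+ size u * cobd (fun s => tau (m + i)%N (u ++ s)) v)).
      by apply: eq_pairing => // v _; rewrite cobd_cat addrK.
    rewrite pairingB // pairing_sign //.
    have -> : pairing Cs (cobd (fun s => tau (m + i)%N (u ++ s))) = 0.
      by apply: pairing_cobd => //; case/andP: cards.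
    by rewrite mulr0 subr0.
  transitivity (pairing Cs (fun v =>
      res_op sh (p.-1 * size Cs + i.+1) (tau (m + i.+1)%N) (u ++ v))).
    apply: eq_pairing => // v fv; rewrite cobd_tau ?addnS //; last first.
    + have uv : facet (C :: Cs) (u ++ v).
        by exists u, v; split=> //; [rewrite uu uj2 uj | apply/allP].
      exact: (proj1 (facet_valid unrel uv)).
    + by apply: leq_trans le_n; rewrite mulnS addnC ltn_add2r.
  have shE a : pairing Cs (fun v => tau (m + i.+1)%N (map (sh a) (u ++ v))) =
               th i.+1 (map (sh a) u).
    rewrite /th -[RHS](pairing_shift p_prime _ a); last first.
      by move=> s x y t; rewrite !catA swap_tau.
    by apply: eq_pairing => // v _; rewrite map_cat.
  have shopE k : pairing Cs (fun v => res_op sh k (tau (m + i.+1)%N) (u ++ v)) =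
                 res_op sh k (th i.+1) u.
    case: k => [//|k]; rewrite /res_op; case: (odd k.+1).
      transitivity (th i.+1 u - pairing Cs (fun v => tau (m + i.+1)%N (map (sh 1) (u ++ v)))).
        exact: pairingB.
      by rewrite shE.
    transitivity (\sum_a pairing Cs (fun v => tau (m + i.+1)%N (map (sh a) (u ++ v)))).
      exact: pairing_sum.
    by apply: eq_bigr => a _; rewrite shE.
  rewrite shopE.
  (* The degrees used up by the other blocks do not change the operator. *)
  apply: res_op_parity => //.
  by case=> x y; rewrite /sh /= add0r.
(* In top degree a tuple of distinct columns is a permutation of [columns], where the value is the
   pairing over [C :: Cs]. *)
have [uj|nuj] := boolP (uniq j); last exact: alternating_nuniq (alternating_cobd _) nuj.
have sp : size j = p by rewrite sj pp.
rewrite cobd_f //; apply: skew_perm (perm_columns p_prime uj sp) _ => //.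
  exact/skew_cobd/skew_placement_sum/th_swap.
by rewrite -[RHS]top mulnS addnC.
Qed.

(** If [tau n] were closed, its pairing with the join would vanish, and descent block by block would
    give [tau 0 [::] = 0]. *)
Theorem chessboard_obstruction v Cs :
  n = (p.-1 * size Cs)%N ->
  all (fun C => #|C| == p.-1) Cs -> pairwise differently_colored Cs ->
  all (differently_colored [set v]) Cs ->
  tau 0 [::] != 0 ->
  (exists2 t, pairwise compatible t & cobd (tau n) t != 0).
Proof.
move=> nE cards unrel vC t0.
apply: contrapT => noT; case/eqP: t0.
have top : pairing Cs (tau (p.-1 * size Cs)) = 0.
  rewrite -nE.
  (* The join bounds its cone with apex [(v, 0)]: the extra term pairs a coboundary with a cycle. As
     the color of [v] differs from those in [Cs], the cone tuples stay compatible. *)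
  have <- : pairing Cs (fun t => cobd (tau n) ((v, 0) :: t)) = pairing Cs (tau n).
    rewrite /= pairingB //.
    by rewrite (pairing_cobd p_prime) // subr0.
  rewrite -[RHS](pairing0 p_prime Cs); apply: eq_pairing => // u fu; apply/eqP.
  apply: contra_notT noT => nz; exists ((v, 0) :: u) => //=.
  have [-> inC] := facet_valid unrel fu; rewrite andbT.
  apply/allP => x /inC [C CC xC].
  have /forall_inP/(_ v (set11 v))/forall_inP/(_ _ xC) vx := allP vC _ CC.
  rewrite /compatible (negPf vx) andbT.
  by apply: contraNneq vx => /= ->.
have le_n : (p.-1 * size Cs <= n)%N by rewrite nE.
clear nE vC noT.
elim: Cs cards unrel top le_n => [|C Cs IH] cards unrel top le_n.
  by move: top; rewrite muln0.
apply: IH.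
- by case/andP: cards.
- by case/andP: unrel.
- exact: pairing_step top.
- by apply: leq_trans le_n; rewrite leq_mul2l /= leqnSn orbT.
Qed.

End ChessboardObstruction.

(** * Equivariant cochains on the complex of labels *)

Section LabelCochains.
Variables (p : nat) (p_prime : prime p) (B : finType).
Local Notation F := 'F_p.
Local Notation sh := (@cell_shift p B).
Implicit Types (t u : seq (B * F)) (f : seq (B * F) -> F) (A : {set F}).

(* Equivariant under shifts since [#|A|] is invertible modulo [p] when
   [0 < #|A| < p]. *)
Definition mean A : F := (\sum_(j in A) j) / #|A|%:R.

Lemma mean_shift A a : (0 < #|A| < p)%N ->
  mean [set a + j | j in A] = a + mean A.
Proof.
move=> /andP[A0 Ap]; have inj : injective (+%R a) := @addrI _ a.
have cA : #|A|%:R != 0 :> F.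
  by rewrite -(dvdn_pcharf (pchar_Fp p_prime)) gtnNdvd.
rewrite /mean card_imset // big_imset /=; last by move=> x y _ _; apply: inj.
by rewrite big_split /= sumr_const mulrDl -[a *+ _]mulr_natr mulfK.
Qed.

(* Tuples of labels that span a simplex of the join of the boundaries of the
   simplices [{k} * 'F_p]. *)
Definition deficient t := [forall k : B, exists j : F, (k, j) \notin t].

Lemma deficient_sub t u : {subset u <= t} -> deficient t -> deficient u.
Proof.
move=> ut /forallP pt; apply/forallP => k; have /existsP[j jt] := pt k.
by apply/existsP; exists j; apply: contra jt; apply: ut.
Qed.

Lemma cell_shift0 x : sh 0 x = x.
Proof. by case: x => k j; rewrite /cell_shift /= add0r. Qed.

Lemma mem_map_shift a t x : (x \in map (sh a) t) = (sh (- a) x \in t).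
Proof.
have shK b : cancel (sh b) (sh (- b)).
  by move=> y; rewrite cell_shiftD addNr cell_shift0.
rewrite -{1}[x](shK (- a)) opprK mem_map //.
exact: can_inj (shK a).
Qed.

Lemma deficient_shift a t : deficient (map (sh a) t) = deficient t.
Proof.
apply: eq_forallb => k; apply/existsP/existsP => -[j jt].
  by exists (- a + j); rewrite mem_map_shift in jt.
by exists (a + j); rewrite mem_map_shift /cell_shift /= addKr.
Qed.

Definition column t (k : B) := [set j : F | (k, j) \in t].

(** An equivariant coordinate on nonempty deficient tuples, witnessing that the action is free. The
    default 0 is taken only at the empty tuple. *)
Definition position t : F :=
  if [pick k | column t k != set0] is Some k then mean (column t k) else 0.

Lemma column_shift a t k : column (map (sh a) t) k = [set a + j | j in column t k].
Proof.
apply/setP => j; rewrite inE mem_map_shift /cell_shift /=.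
apply/idP/imsetP => [jt|[i]]; first by exists (- a + j); rewrite ?inE ?addNKr.
by rewrite inE => it ->; rewrite addKr.
Qed.

Lemma eq_position t u : t =i u -> position t = position u.
Proof.
move=> tu; have E k : column t k = column u k by apply/setP => j; rewrite !inE tu.
rewrite /position (eq_pick (fun k => congr1 (fun A => A != set0) (E k))).
by case: pickP => // k _; rewrite E.
Qed.

Lemma position_shift a t : t != [::] -> deficient t ->
  position (map (sh a) t) = a + position t.
Proof.
move=> t0 pt; rewrite /position.
have E k : (column (map (sh a) t) k != set0) = (column t k != set0).
  by rewrite column_shift imset_eq0.
rewrite (eq_pick E); case: pickP => [k ck|none].
  rewrite column_shift mean_shift // card_gt0 ck /=.
  have /forallP/(_ k)/existsP[j jt] := pt.
  rewrite -[X in (_ < X)%N](card_Fp p_prime) -cardsT; apply: proper_card.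
  by apply/properP; split; [apply: subsetT | exists j; rewrite ?inE].
case: t t0 none {pt E} => // -[k j] t _ /(_ k) /negbFE/eqP/setP/(_ j).
by rewrite !inE eqxx.
Qed.

(** Every orbit of nonempty deficient tuples meets position 0 exactly once, so summing over the
    orbit recovers an invariant [f]. *)
Definition solve_orbit_sum f t := if position t == 0 then f t else 0.

(** A discrete primitive of [f] along the orbit, normalized to be 0 at position 0. *)
Definition solve_shift_diff f t :=
  - \sum_(0 <= i < position t) f (map (sh (- i.+1%:R)) t).

Lemma solve_orbit_sumP f t : t != [::] -> deficient t ->
  (forall a, f (map (sh a) t) = f t) -> orbit_sum sh (solve_orbit_sum f) t = f t.
Proof.
move=> t0 pt inv; rewrite /orbit_sum /solve_orbit_sum.
rewrite (bigD1 (- position t)) //= position_shift // addNr eqxx inv.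
rewrite big1 ?addr0 // => a na; rewrite position_shift //.
by rewrite addr_eq0 (negPf na).
Qed.

Lemma sum_Fp (f : F -> F) : \sum_a f a = \sum_(0 <= i < p) f i%:R.
Proof.
have E m n (g : nat -> F) : m = n -> \sum_(0 <= i < m) g i = \sum_(0 <= i < n) g i.
  by move=> ->.
rewrite -(E _ _ _ (Fp_cast p_prime)) big_mkord; apply: eq_bigr => a _.
by rewrite natr_Zp.
Qed.

Lemma solve_shift_diffP f t : t != [::] -> deficient t ->
  orbit_sum sh f t = 0 -> shift_diff sh (solve_shift_diff f) t = f t.
Proof.
move=> t0 pt; rewrite /orbit_sum (reindex_inj oppr_inj) sum_Fp => nf.
rewrite /shift_diff /solve_shift_diff opprK addrC position_shift //.
have p0 := prime_gt0 p_prime.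
have kp : (position t < p)%N by rewrite -[X in (_ < X)%N](Fp_cast p_prime) ltn_ord.
have fE i : f (map (sh (- i.+1%:R)) (map (sh 1) t)) = f (map (sh (- i%:R)) t).
  by rewrite (map_shD (@cell_shiftD p B)) mulrS opprD addrAC addNr add0r.
have f0 : f (map (sh (- 0%:R)) t) = f t.
  by rewrite oppr0 (map_sh0 cell_shift0).
have E : nat_of_ord (1 + position t) = ((position t).+1 %% p)%N.
  by rewrite -{1}[position t]natr_Zp -mulrS val_Fp_nat.
rewrite E; have [lt|ge] := ltnP (position t).+1 p.
  rewrite modn_small // (eq_bigr _ (fun i _ => fE i)) big_nat_recl // f0.
  by rewrite addrK.
(* At the last position the shift wraps around to position 0, where the primitive is 0; the missing
   term is supplied by the vanishing sum over the whole orbit. *)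
have {ge}Ep : (position t).+1 = p by apply/eqP; rewrite eqn_leq kp.
rewrite Ep modnn big_geq // sub0r; apply/eqP; rewrite eq_sym -addr_eq0.
move: nf; have S m n (g : nat -> F) : m = n ->
    \sum_(0 <= i < m) g i = \sum_(0 <= i < n) g i by move=> ->.
by rewrite -(S _ _ _ Ep) big_nat_recl // f0 => ->.
Qed.

Fixpoint label_cochain i : seq (B * F) -> F :=
  if i is i'.+1 then
    if odd i then solve_shift_diff (cobd (label_cochain i'))
    else solve_orbit_sum (cobd (label_cochain i'))
  else fun t => (t == [::])%:R.

Lemma swap_mem (s : seq (B * F)) x y t : s ++ [:: x, y & t] =i s ++ [:: y, x & t].
Proof. by move=> z; rewrite !mem_cat !inE; congr (_ || _); rewrite orbCA. Qed.

Lemma alternating_label_cochain i : alternating_cochain (label_cochain i).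
Proof.
elim: i => [|i /alternating_cobd [sf zf]] /=.
  by split=> [s x y t|s x t]; case: s => [|? ?] //; apply/esym/oppr0.
case: ifP => _; rewrite /solve_shift_diff /solve_orbit_sum; split=> s x.
- move=> y t; rewrite (eq_position (swap_mem s x y t)) -!sumrN.
  by apply: eq_bigr => j _; rewrite !map_cat /= sf.
- by move=> t; rewrite big1 ?oppr0 // => j _; rewrite map_cat /= zf.
- by move=> y t; rewrite (eq_position (swap_mem s x y t)) sf; case: ifP; rewrite ?oppr0.
- by move=> t; rewrite zf if_same.
Qed.

Lemma label_cochain_size i t : size t != i -> label_cochain i t = 0.
Proof.
elim: i t => [|i IH] t; first by case: t.
have cobd_size u : size u != i.+1 -> cobd (label_cochain i) u = 0.
  move=> su; rewrite -[RHS](@cobd0 F _ u); apply: eq_in_cobd => v _ sv.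
  by apply: IH; rewrite -eqSS sv.
move=> st /=; case: ifP => _; rewrite /solve_shift_diff /solve_orbit_sum.
  by rewrite big1 ?oppr0 // => j _; rewrite cobd_size ?size_map.
by rewrite cobd_size // if_same.
Qed.

(** Each equation is solvable because the other operator kills the given coboundary: it commutes
    with [cobd], and [cobd] applied twice is zero. At the start the coboundary is invariant, so its
    orbit sum is a multiple of p. *)
Lemma cobd_label_cochain i t : deficient t ->
  cobd (label_cochain i) t = res_op sh i.+1 (label_cochain i.+1) t.
Proof.
elim: i t => [|i IH] t pt.
  have [->|t0] := eqVneq t [::].
    by rewrite /= /shift_diff subrr.
  rewrite /= solve_shift_diffP // /orbit_sum.
  transitivity (\sum_(a : F) cobd (fun u : seq (B * F) => (u == [::])%:R : F) t).
    apply: eq_bigr => a _; rewrite -cobd_map; apply: eq_cobd => u.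
    by case: u.
  by rewrite sumr_const card_Fp // -mulr_natr pchar_Fp_0 // mulr0.
have kill u : deficient u -> res_op sh i.+1 (cobd (label_cochain i.+1)) u = 0.
  move=> pu; rewrite -cobd_res_op -(cobd_cobd (label_cochain i) u).
  apply: eq_in_cobd => v vu _; rewrite -IH //.
  by apply: deficient_sub pu; apply: mem_subseq.
have [->|t0] := eqVneq t [::].
  rewrite /res_op; case: ifP => _; first by rewrite /shift_diff subrr.
  by rewrite /orbit_sum big1 // => a _; apply: label_cochain_size.
have sE : label_cochain i.+2 = if odd i.+2 then solve_shift_diff (cobd (label_cochain i.+1))
                       else solve_orbit_sum (cobd (label_cochain i.+1)) by [].
move: kill; rewrite sE; move: (cobd _) => g {sE}.
rewrite /res_op /= negbK; case: (odd i) => /= K.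
  by rewrite solve_shift_diffP // K.
(* Being killed by 1 - g is invariance under the unit shift, which iterates to all shifts. *)
rewrite solve_orbit_sumP // => a; rewrite -[a]natr_Zp.
elim: (val a) => [|n IHn].
  by rewrite (map_sh0 cell_shift0).
rewrite -IHn; apply/eqP; rewrite eq_sym -subr_eq0; apply/eqP.
rewrite mulrS -(map_shD (@cell_shiftD p B)).
by apply: (K (map (sh n%:R) t)); rewrite deficient_shift.
Qed.

(** A deficient tuple of distinct labels misses one label for each [k], so it has at most
    [p.-1 * #|B|] entries, and its faces are too short for the top cochain. *)
Lemma cobd_label_cochain_top t : deficient t -> cobd (label_cochain (p.-1 * #|B|)) t = 0.
Proof.
move=> pt; have [ut|nut] := boolP (uniq t); last first.
  exact: alternating_nuniq (alternating_cobd (alternating_label_cochain _)) nut.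
rewrite -[RHS](@cobd0 F _ t); apply: eq_in_cobd => v _ sv.
apply: label_cochain_size; rewrite -eqSS sv neq_ltn ltnS; apply/orP; left.
have /forallP ex := pt.
pose g k := (k, xchoose (existsP (ex k))).
have ginj : injective g by move=> x y [].
rewrite -(card_uniqP ut).
apply: (@leq_trans #|~: [set g k | k : B]|).
  apply/subset_leq_card/subsetP => x xt; rewrite inE; apply/imsetP => -[k _ xE].
  by have := xchooseP (existsP (ex k)); rewrite -/(g k) -xE xt.
have := cardsC [set g k | k : B]; rewrite card_imset // cardsE cardE -cardE.
rewrite card_prod card_Fp // => E.
by rewrite -(leq_add2l #|B|) E -mulSn prednK ?prime_gt0 // mulnC.
Qed.

End LabelCochains.

From mathcomp Require Import all_classical all_reals all_analysis.
From mathcomp Require Import ring lra.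

Import numFieldNormedType.Exports.

Local Open Scope classical_set_scope.
Local Open Scope ring_scope.

(** * Barycentric subdivision *)

Section Barycenter.
Variables (R : realType) (V : normedModType R).
Implicit Types (s t u : seq V).

Definition barycenter t : V := (size t)%:R^-1 *: \sum_(x <- t) x.

Lemma perm_barycenter s t : perm_eq s t -> barycenter s = barycenter t.
Proof. by move=> st; rewrite /barycenter (perm_size st) (perm_big _ st). Qed.

Lemma barycenterB t v : t != [::] ->
  barycenter t - v = (size t)%:R^-1 *: \sum_(x <- t) (x - v).
Proof.
rewrite -size_eq0 => t0; have n0 : (size t)%:R != 0 :> R by rewrite pnatr_eq0.
rewrite sumrB scalerBr big_const_seq count_predT iter_addr_0.
by rewrite -[v *+ _]scaler_nat scalerA mulVf // scale1r.
Qed.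

Definition barycentric_closed (H : V -> Prop) :=
  forall t, t != [::] -> (forall x, x \in t -> H x) -> H (barycenter t).

Lemma norm_barycenterB t v d : t != [::] ->
  \sum_(x <- t) `|x - v| <= d * (size t)%:R -> `|barycenter t - v| <= d.
Proof.
move=> t0 le; rewrite barycenterB // normrZ ger0_norm ?invr_ge0 ?ler0n //.
have n0 : 0 < (size t)%:R :> R by rewrite ltr0n lt0n size_eq0.
rewrite mulrC ler_pdivrMr //; apply: le_trans le; exact: ler_norm_sum.
Qed.

Lemma ball_barycentric_closed v d : barycentric_closed (fun x => `|x - v| <= d).
Proof.
move=> t t0 tv; apply: norm_barycenterB => //.
rewrite big_seq; apply: (@le_trans _ _ (\sum_(x <- t | x \in t) d)).
  by apply: ler_sum => x; apply: tv.
rewrite -big_seq big_const_seq count_predT iter_addr_0 mulr_natr //.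
Qed.

(** In an average over at most [n.+1] distances, [v] itself contributes 0 and the others at most
    [d]. *)
Lemma barycenter_vertex_dist t v d n : v \in t -> (size t <= n.+1)%N ->
  (forall x y, x \in t -> y \in t -> `|x - y| <= d) ->
  `|barycenter t - v| <= (1 - n.+1%:R^-1) * d.
Proof.
move=> vt tn td; have t0 : t != [::] by apply: contraTneq vt => ->.
have n0 : 0 < (size t)%:R :> R by rewrite ltr0n lt0n size_eq0.
have d0 : 0 <= d by apply: le_trans (td v v vt vt).
apply: norm_barycenterB => //; apply: (@le_trans _ _ (d * (size t).-1%:R)).
  rewrite (perm_big _ (perm_to_rem vt)) big_cons /= subrr normr0 add0r.
  rewrite big_seq; apply: (@le_trans _ _ (\sum_(x <- rem v t | x \in rem v t) d)).
    by apply: ler_sum => x /mem_rem xt; apply: td.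
  by rewrite -big_seq big_const_seq count_predT iter_addr_0 size_rem // mulr_natr.
rewrite mulrAC [_ * d]mulrC ler_wpM2l // mulrBl mul1r.
rewrite -subn1 natrB; last by rewrite lt0n size_eq0.
rewrite lerD2l lerN2 mulrC ler_pdivrMr ?ltr0n // mul1r ler_nat //.
Qed.

End Barycenter.

Section Subdivision.
Variables (R : realType) (V : normedModType R) (K : nzRingType).
Implicit Types (f g : seq V -> K) (s t u : seq V).

(* [sd n f t] is the value of the cochain [f] on the barycentric subdivision
   [Sd t = barycenter t * Sd (boundary t)] of the [n]-tuple [t]. *)
Fixpoint sd n f t : K :=
  if n is n'.+1 then cobd (sd n' (fun u => f (barycenter t :: u))) t
  else if t is [::] then f [::] else 0.

Fixpoint sd_support n t u : Prop :=
  if n is n'.+1 then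
    exists s u', [/\ u = barycenter t :: u', subseq s t, (size s).+1 = size t &
      sd_support n' s u']
  else t = [::] /\ u = [::].

Lemma sd_support_size n t u : sd_support n t u -> size t = n /\ size u = n.
Proof.
elim: n t u => [|n IH] t u /=; first by case=> -> ->.
by case=> s [u' [-> _ <- /IH[-> /= ->]]].
Qed.

Lemma eq_in_sd n f g t :
  (forall u, sd_support n t u -> f u = g u) -> sd n f t = sd n g t.
Proof.
elim: n f g t => [|n IH] f g t fg /=.
  by case: t fg => // /(_ [::]) ->.
apply: eq_in_cobd => s st ss; apply: IH => u su; apply: fg => /=.
by exists s, u.
Qed.

Lemma eq_sd n f g t : f =1 g -> sd n f t = sd n g t.
Proof. by move=> fg; apply: eq_in_sd => u _; apply: fg. Qed.

Lemma sdB n f g t : sd n (fun u => f u - g u) t = sd n f t - sd n g t.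
Proof.
elim: n f g t => [|n IH] f g t /=; first by case: t; rewrite ?subrr.
by rewrite -cobdB; apply: eq_cobd => u; rewrite IH.
Qed.

Lemma sd_sum n (I : finType) (G : I -> seq V -> K) t :
  sd n (fun u => \sum_i G i u) t = \sum_i sd n (G i) t.
Proof.
elim: n G t => [|n IH] G t /=; first by case: t => //; rewrite big1.
by rewrite -cobd_sum; apply: eq_cobd => u; rewrite IH.
Qed.

Lemma sd0 n t : sd n (fun=> 0) t = 0.
Proof.
by rewrite -[RHS](subrr (sd n (fun=> 0) t)) -sdB; apply: eq_sd => u; rewrite subrr.
Qed.

(** Subdivision is a chain map: in the boundary of the cone from the barycenter, the part that is
    still coned subdivides a double boundary. *)
Lemma sd_cobd n f t : sd n.+1 (cobd f) t = cobd (sd n f) t.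
Proof.
elim: n f t => [|n IH] f t.
  rewrite /=; apply: eq_cobd => -[|x u] //=; first by rewrite subr0.
have -> : sd n.+2 (cobd f) t =
  cobd (sd n.+1 (fun u => cobd f (barycenter t :: u))) t by [].
rewrite -[RHS]subr0.
rewrite -(cobd_cobd (sd n (fun u => f (barycenter t :: u))) t) -cobdB.
apply: eq_cobd => u; rewrite -IH -sdB; exact: eq_sd.
Qed.

Lemma sd_map (h : V -> V) n f t :
  (forall u, h (barycenter u) = barycenter (map h u)) ->
  sd n (fun u => f (map h u)) t = sd n f (map h t).
Proof.
move=> hb; elim: n f t => [|n IH] f t /=; first by case: t.
rewrite -cobd_map; apply: eq_cobd => u.
by rewrite (IH (fun u => f (h (barycenter t) :: u))) hb.
Qed.

Lemma skew_sd n f : skew_cochain (sd n f).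
Proof.
suff : alternating_cochain (sd n f) by case.
elim: n f => [|n IH] f.
  by split=> [s x y t|s x t]; case: s => [|? ?] //=; rewrite oppr0.
split=> s x => [y t|t] /=; last first.
  by case: (alternating_cobd (IH (fun u => f (barycenter (s ++ [:: x, x & t]) :: u)))).
rewrite (@perm_barycenter _ _ (s ++ [:: x, y & t]) (s ++ [:: y, x & t])); last first.
  by rewrite perm_cat2l; apply/permPl/(perm_catCA [:: x] [:: y] t).
set c := barycenter _.
by case: (alternating_cobd (IH (fun u => f (c :: u)))).
Qed.

Lemma sd_support_closed (H : V -> Prop) n t u : barycentric_closed H ->
  sd_support n t u -> (forall x, x \in t -> H x) -> forall x, x \in u -> H x.
Proof.
move=> Hb; elim: n t u => [|n IH] t u /=; first by case=> _ ->.
case=> s [u' [-> st ss su]] Ht x; rewrite inE => /orP[/eqP->|].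
  by apply: Hb => //; rewrite -size_eq0 -ss.
by apply: (IH s) => // y ys; apply/Ht/(mem_subseq st).
Qed.

(** The bound from the barycenter to the vertices extends to all subdivision points, since balls are
    closed under barycenters; pairs avoiding the barycenter lie in a proper face, by induction. *)
Lemma sd_support_dist n m t u d : (n <= m.+1)%N ->
  sd_support n t u -> (forall x y, x \in t -> y \in t -> `|x - y| <= d) ->
  forall x y, x \in u -> y \in u -> `|x - y| <= (1 - m.+1%:R^-1) * d.
Proof.
elim: n t u => [|n IH] t u nm /=; first by case=> _ ->.
case=> s [u' [-> st ss su]] td.
have [sn _] := sd_support_size su.
have near x : x \in u' -> `|barycenter t - x| <= (1 - m.+1%:R^-1) * d.
  rewrite distrC; move: x.
  apply: (sd_support_closed (@ball_barycentric_closed _ _ _ _) su).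
  move=> x /(mem_subseq st) xt; rewrite distrC.
  by apply: barycenter_vertex_dist => //; rewrite -ss sn.
have [v vt] : exists v, v \in t.
  by case: (t) ss => // v t' _; exists v; rewrite mem_head.
move=> x y; rewrite !inE => /orP[/eqP->|xu] /orP[/eqP->|yu].
- rewrite subrr normr0 mulr_ge0 ?subr_ge0 ?invf_le1 ?ltr0n ?ler1n //.
  by apply: le_trans (td v v vt vt).
- exact: near.
- by rewrite distrC; apply: near.
- apply: (IH s u') => //; first exact: ltnW.
  by move=> a b /(mem_subseq st) ? /(mem_subseq st) ?; apply: td.
Qed.

(** Iterated subdivision evaluates cochains only on tuples inside [H] whose diameter has shrunk
    geometrically, so agreement on these suffices. *)
Lemma eq_in_iter_sd k n m f g t d (H : V -> Prop) :
  (n <= m.+1)%N -> barycentric_closed H -> (forall x, x \in t -> H x) ->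
  (forall x y, x \in t -> y \in t -> `|x - y| <= d) ->
  (forall u, (forall x, x \in u -> H x) ->
     (forall x y, x \in u -> y \in u -> `|x - y| <= (1 - m.+1%:R^-1) ^+ k * d) ->
     f u = g u) ->
  iter k (sd n) f t = iter k (sd n) g t.
Proof.
move=> nm Hb; elim: k t d => [|k IH] t d Ht td fg /=.
  by apply: fg => // x y xt yt; rewrite expr0 mul1r td.
apply: eq_in_sd => u su; apply: (IH u ((1 - m.+1%:R^-1) * d)).
- exact: sd_support_closed su Ht.
- exact: sd_support_dist su td.
- by move=> v vH vd; apply: fg => // x y xv yv; rewrite exprSr -mulrA vd.
Qed.

Lemma eq_iter_sd k n f g t : f =1 g -> iter k (sd n) f t = iter k (sd n) g t.
Proof. by move=> fg; elim: k t => //= k IH t; apply: (eq_sd n _ IH). Qed.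

Lemma iter_sdB k n f g t :
  iter k (sd n) (fun u => f u - g u) t = iter k (sd n) f t - iter k (sd n) g t.
Proof. by elim: k t => //= k IH t; rewrite -sdB; apply: (eq_sd _ _ IH). Qed.

Lemma iter_sd_sum k n (I : finType) (G : I -> seq V -> K) t :
  iter k (sd n) (fun u => \sum_i G i u) t = \sum_i iter k (sd n) (G i) t.
Proof. by elim: k t => //= k IH t; rewrite -sd_sum; apply: (eq_sd _ _ IH). Qed.

Lemma iter_sd_cobd k n f t : iter k (sd n.+1) (cobd f) t = cobd (iter k (sd n) f) t.
Proof. by elim: k t => [//|k IH] t; rewrite !iterS -sd_cobd; apply: (eq_sd _ _ IH). Qed.

Lemma iter_sd_map (h : V -> V) k n f t :
  (forall u, h (barycenter u) = barycenter (map h u)) ->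
  iter k (sd n) (fun u => f (map h u)) t = iter k (sd n) f (map h t).
Proof. by move=> hb; elim: k t => //= k IH t; rewrite -sd_map //; apply: (eq_sd _ _ IH). Qed.

End Subdivision.

(** * Labellings of chessboard points *)

Section Labelling.
Variables (R : realType) (p : nat) (p_prime : prime p) (X : finType).
Variables (I : eqType) (col : X -> I).
Local Notation F := 'F_p.
Local Notation V := 'rV[R]_#|{: X * F}|.
Local Notation sh := (@cell_shift p X).
Implicit Types (w : V) (c : X * F) (t : seq (X * F)).

Definition weight w c : R := w ord0 (enum_rank c).

Definition vertex c : V := delta_mx ord0 (enum_rank c).

Definition weight_shift a w : V := \row_k weight w (sh (- a) (enum_val k)).

Definition chessboard_point w :=
  [/\ forall c, 0 <= weight w c, \sum_c weight w c = 1 &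
      forall c c', weight w c != 0 -> weight w c' != 0 -> c != c' ->
        compatible col c c'].

Lemma weightE a w c : weight (weight_shift a w) c = weight w (sh (- a) c).
Proof. by rewrite /weight mxE enum_rankK. Qed.

Lemma weight_vertex c c' : weight (vertex c) c' = (c' == c)%:R.
Proof. by rewrite /weight mxE eqxx (inj_eq enum_rank_inj). Qed.

Lemma weightP w w' : (forall c, weight w c = weight w' c) -> w = w'.
Proof. by move=> ww; apply/rowP => k; have := ww (enum_val k); rewrite /weight enum_valK. Qed.

Lemma weight_barycenter (s : seq V) c :
  weight (barycenter s) c = (size s)%:R^-1 * \sum_(x <- s) weight x c.
Proof. by rewrite /weight mxE summxE. Qed.

Lemma weight_shift_barycenter a (s : seq V) :
  weight_shift a (barycenter s) = barycenter (map (weight_shift a) s).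
Proof.
apply: weightP => c; rewrite weightE !weight_barycenter size_map big_map.
by congr (_ * _); apply: eq_bigr => x _; rewrite weightE.
Qed.

Lemma weight_shift_vertex a c : weight_shift a (vertex c) = vertex (sh a c).
Proof.
apply: weightP => c'; rewrite weightE !weight_vertex; congr ((_ : bool)%:R).
apply/eqP/eqP => [<-|->]; rewrite cell_shiftD ?subrr ?addNr cell_shift0 //.
Qed.

Lemma compatible_sym c c' : compatible col c c' = compatible col c' c.
Proof. by rewrite /compatible eq_sym [col _ == _]eq_sym [c.2 == _]eq_sym. Qed.

Lemma pairwise_compatible t c c' : pairwise (compatible col) t ->
  c \in t -> c' \in t -> c != c' -> compatible col c c'.
Proof.
elim: t => //= x t IH /andP[/allP xt pt]; rewrite !inE.
move=> /orP[/eqP->|ct] /orP[/eqP->|c't] cc'; first by rewrite eqxx in cc'.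
- exact: xt.
- by rewrite compatible_sym; apply: xt.
- exact: IH.
Qed.

Definition cell t w :=
  [/\ forall c, 0 <= weight w c, \sum_c weight w c = 1 &
      forall c, weight w c != 0 -> c \in t].

Lemma cell_point t w : pairwise (compatible col) t -> cell t w -> chessboard_point w.
Proof.
move=> pt [w0 w1 wt]; split=> // c c' /wt ct /wt c't; exact: (pairwise_compatible pt ct c't).
Qed.

Lemma cell_vertex t c : c \in t -> cell t (vertex c).
Proof.
move=> ct; split=> [c'||c']; rewrite ?weight_vertex ?ler0n //.
  rewrite (bigD1 c) //= weight_vertex eqxx big1 ?addr0 // => c' /negPf cc'.
  by rewrite weight_vertex cc'.
by rewrite pnatr_eq0 eqb0 negbK => /eqP->.
Qed.

Lemma cell_barycentric_closed t : barycentric_closed (cell t).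
Proof.
move=> s s0 sc; have n0 : 0 < (size s)%:R :> R by rewrite ltr0n lt0n size_eq0.
split=> [c||c].
- rewrite weight_barycenter mulr_ge0 ?invr_ge0 ?(ltW n0) //.
  by rewrite big_seq; apply: sumr_ge0 => x xs; case: (sc x xs).
- under eq_bigr do rewrite weight_barycenter.
  rewrite -mulr_sumr exchange_big /= big_seq.
  rewrite (eq_bigr (fun=> 1)); last by move=> x xs; case: (sc x xs).
  by rewrite -big_seq big_const_seq count_predT iter_addr_0 mulVf // lt0r_neq0.
rewrite weight_barycenter; apply: contraNT => ct.
rewrite big_seq big1 ?mulr0 // => x xs; apply/eqP; apply: contraNT ct.
by case: (sc x xs) => _ _; apply.
Qed.

Lemma geometric_small (q d e : R) : 0 <= q < 1 -> 0 < e ->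
  exists k, q ^+ k * d < e.
Proof.
move=> /andP[q0 q1] e0.
have qc : (fun k => q ^+ k * d) @ \oo --> (0 : R).
  rewrite -[X in _ --> X](mul0r d); apply: cvgMl; apply: cvg_expr.
  by rewrite ger0_norm.
have /cvgrPdist_lt/(_ e e0) [k _ H] := qc.
exists k; have := H k (leqnn k); rewrite sub0r normrN.
by apply: le_lt_trans; rewrite ler_norm.
Qed.

Variables (B : finType) (lab : V -> B * F).

(** If all small tuples were deficient, the label cochains pulled back along a fine subdivision
    would satisfy the relations that [chessboard_obstruction] excludes. *)
Theorem small_nondeficient_tuple Cs v (e : R) : 0 < e ->
  (forall a w, chessboard_point w -> lab (weight_shift a w) = cell_shift a (lab w)) ->
  size Cs = #|B| ->
  all (fun C : {set X} => #|C| == p.-1) Cs -> pairwise (differently_colored col) Cs ->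
  all (differently_colored col [set v]%SET) Cs ->
  exists u : seq V, [/\ forall w, w \in u -> chessboard_point w,
    forall w w', w \in u -> w' \in u -> `|w - w'| < e & ~~ deficient (map lab u)].
Proof.
move=> e0 equiv sCs cards unrel vC; apply: contrapT => noU.
pose n := (p.-1 * size Cs)%N.
pose d : R := \sum_c \sum_c' `|vertex c - vertex c'|.
have dP c c' : `|vertex c - vertex c'| <= d.
  rewrite /d (bigD1 c) //= (bigD1 c') //= -addrA lerDl addr_ge0 ?sumr_ge0 // => *.
  exact: sumr_ge0.
have q01 : 0 <= (1 - n.+1%:R^-1 : R) < 1.
  by rewrite subr_ge0 invf_le1 ?ltr0n // ler1n /= ltrBlDr ltrDl invr_gt0 ltr0n.
(* At least one subdivision is made, so that [skew_sd] makes the pulled-back cochains skew. *)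
have [k kP] : exists k, (1 - n.+1%:R^-1 : R) ^+ k.+1 * d < e.
  have [k kP] := geometric_small ((1 - n.+1%:R^-1) * d) q01 e0.
  by exists k; rewrite exprSr -mulrA.
pose pull i (f : seq (B * F) -> F) t := iter k.+1 (sd i) (fun u => f (map lab u)) (map vertex t).
have near_deficient i f g t : (i <= n.+1)%N -> pairwise (compatible col) t ->
    (forall u, deficient u -> f u = g u) -> pull i f t = pull i g t.
  move=> i_n pt fg; apply: (@eq_in_iter_sd _ _ _ k.+1 i n _ _ _ d (cell t)) => //.
  - exact: cell_barycentric_closed.
  - by move=> x /mapP[c ct ->]; apply: cell_vertex.
  - by move=> x y /mapP[c ct ->] /mapP[c' ct' ->].
  move=> u uc ud; apply: fg; apply: contrapT => /negP np; apply: noU; exists u.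
  split=> // [w wu|w w' wu w'u]; first exact/cell_point/uc.
  exact: le_lt_trans (ud _ _ wu w'u) kP.
have pull_shift i f t a : (i <= n.+1)%N -> pairwise (compatible col) t ->
    pull i f (map (sh a) t) = pull i (fun u => f (map (cell_shift a) u)) t.
  move=> i_n pt.
  have -> : pull i f (map (sh a) t) =
      iter k.+1 (sd i) (fun u => f (map lab (map (weight_shift a) u))) (map vertex t).
    rewrite (iter_sd_map k.+1 i (fun u => f (map lab u)) _ (weight_shift_barycenter a)).
    rewrite /pull -!map_comp; congr (iter _ _ _ _); apply: eq_map => c /=.
    by rewrite weight_shift_vertex.
  apply: (@eq_in_iter_sd _ _ _ k.+1 i n _ _ _ d (cell t)) => //.
  - exact: cell_barycentric_closed.
  - by move=> x /mapP[c ct ->]; apply: cell_vertex.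
  - by move=> x y /mapP[c ct ->] /mapP[c' ct' ->].
  move=> u uc _; congr f; rewrite -!map_comp; apply/eq_in_map => w wu /=.
  by rewrite equiv //; apply/cell_point/uc.
pose tau i := pull i (@label_cochain p B i).
have cobd_tau i t : (i <= n)%N -> pairwise (compatible col) t ->
    cobd (tau i) t = pull i.+1 (cobd (@label_cochain p B i)) t.
  move=> i_n pt; rewrite /tau /pull.
  pose g u := @label_cochain p B i (map lab u).
  transitivity (cobd (iter k.+1 (sd i) g) (map vertex t)).
    exact: (cobd_map vertex (iter k.+1 (sd i) g)).
  rewrite -iter_sd_cobd; apply: eq_iter_sd => u.
  exact: cobd_map.
have rel i t : (i < n)%N -> pairwise (compatible col) t ->
    cobd (tau i) t = res_op sh i.+1 (tau i.+1) t.
  move=> i_n pt; rewrite cobd_tau //; last exact: ltnW.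
  have i_n2 := ltnW (i_n : (i.+1 < n.+1)%N).
  rewrite (near_deficient _ _
    (res_op (@cell_shift p B) i.+1 (@label_cochain p B i.+1))) //; last first.
    exact: cobd_label_cochain.
  rewrite /res_op /tau; case: (odd i.+1); rewrite /shift_diff /orbit_sum.
    by rewrite pull_shift // /pull -iter_sdB.
  rewrite /pull iter_sd_sum; apply: eq_bigr => a _.
  by rewrite -/(pull _ _ _) pull_shift.
have [||t pt] := @chessboard_obstruction p p_prime X I col tau n _ rel v Cs erefl
    cards unrel vC.
- move=> i s x y t; rewrite /tau /pull !map_cat /=.
  exact: skew_sd.
- rewrite (_ : tau 0 [::] = 1) ?oner_neq0 // /tau /pull.
  by elim: (k.+1) => //= k' ->.
case/negP; apply/eqP; rewrite cobd_tau // (near_deficient _ _ (fun=> 0)) //.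
  rewrite /pull; elim: (k.+1) (map _ _) => [//|k' IH] s.
  by rewrite iterS -[RHS](@sd0 _ _ F n.+1 s); apply: eq_sd.
by move=> u pu; rewrite /n sCs; apply: cobd_label_cochain_top.
Qed.

End Labelling.

(** * The labelling defined by a map without coincidences *)

Section Choice.
Variables (p : nat) (p_prime : prime p).
Local Notation F := 'F_p.
Implicit Types A : {set F}.

(** Choosing an offset from the mean, rather than an element, makes the choice commute with shifts;
    the default is reached only for empty [A]. *)
Definition equivariant_choice A : F :=
  mean A + odflt 0 [pick a | mean A + a \in A].

Lemma equivariant_choice_in A : A != finset.set0 -> equivariant_choice A \in A.
Proof.
move=> /set0Pn[a aA]; rewrite /equivariant_choice; case: pickP => //=.
by move=> /(_ (a - mean A)); rewrite addrC subrK aA.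
Qed.

Lemma equivariant_choice_shift A a : A != finset.set0 -> A != [set: F]%SET ->
  equivariant_choice [set a + j | j in A]%SET = a + equivariant_choice A.
Proof.
move=> A0 AT; rewrite /equivariant_choice mean_shift //; last first.
  rewrite card_gt0 A0 /= -[X in (_ < X)%N](card_Fp p_prime) -cardsT.
  by apply: proper_card; rewrite properT.
rewrite -addrA; congr (_ + (_ + odflt _ _)); apply: eq_pick => b.
by rewrite -!addrA mem_imset //; apply: addrI.
Qed.

End Choice.

Section Spread.
Variables (R : realType) (J : finType).
Implicit Types a b : J -> R.

Definition spread a : R := \sum_j \sum_j' `|a j - a j'|.

Lemma spread_ge0 a : 0 <= spread a.
Proof. by apply: sumr_ge0 => j _; apply: sumr_ge0. Qed.

Lemma spread_eq0 a : spread a = 0 -> forall j j', a j = a j'.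
Proof.
move=> /eqP; rewrite psumr_eq0 => [/allP H j j'|j _]; last exact: sumr_ge0.
have := H j (mem_index_enum j); rewrite psumr_eq0 // => /allP/(_ j' (mem_index_enum j')).
by rewrite normr_eq0 subr_eq0 => /eqP.
Qed.

Lemma const_spread a : (forall j j', a j = a j') -> spread a = 0.
Proof.
move=> E; rewrite /spread big1 // => j _; rewrite big1 // => j' _.
by rewrite (E j j') subrr normr0.
Qed.

Lemma spread_le a b c : (forall j j', `|a j - a j'| <= `|b j - b j'| + c) ->
  spread a <= spread b + c * #|J|%:R ^+ 2.
Proof.
move=> ab; have -> : c * #|J|%:R ^+ 2 = \sum_(j : J) \sum_(j' : J) c.
  by rewrite !sumr_const -[RHS]mulr_natr -[c *+ _]mulr_natr expr2 mulrA.
rewrite -big_split; apply: ler_sum => j _; rewrite -big_split.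
by apply: ler_sum.
Qed.

End Spread.

Lemma cvg_sum_fin (R : realType) (T : Type) (G : set_system T) {FG : Filter G}
  (W : normedModType R) (I : finType) (g : I -> T -> W) (l : I -> W) :
  (forall i, g i x @[x --> G] --> l i) ->
  (\sum_i g i x) @[x --> G] --> \sum_i l i.
Proof.
move=> gl; elim: (index_enum I) => [|i r IH].
  have -> : (fun x => \sum_(i <- [::]) g i x) = (fun=> 0) by apply/funext => x; rewrite big_nil.
  by rewrite big_nil; apply: cvg_cst.
have -> : (fun x => \sum_(j <- i :: r) g j x) = (fun x => g i x + \sum_(j <- r) g j x).
  by apply/funext => x; rewrite big_cons.
by rewrite big_cons; apply: cvgD.
Qed.

Section Tverberg.
Variables (R : realType) (p : nat) (p_prime : prime p) (d N m : nat).
Variables (v : 'I_N.+1 -> 'rV[R]_m) (f : 'rV[R]_m -> 'rV[R]_d).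
Variables (I : eqType) (col : 'I_N.+1 -> I).
Local Notation F := 'F_p.
Local Notation X := 'I_N.+1.
Local Notation V := 'rV[R]_#|{: X * F}|.
Local Notation point_of := (@chessboard_point R p X I col).
Implicit Types (w x : V) (j : F) (k : 'I_d.+1).

Definition mass w j : R := \sum_(i : X) weight w (i, j).

Definition position_in w j := \sum_(i : X) (weight w (i, j) / mass w j) *: v i.

(** Index [ord0] carries the mass and the others the [d] coordinates of the image, so constancy in
    [j] for every [k] is a coincidence with equal masses. *)
Definition value w k j : R :=
  if unlift ord0 k is Some l then f (position_in w j) ord0 l else mass w j.

Lemma mass_shift a w j : mass (weight_shift a w) j = mass w (- a + j).
Proof. by apply: eq_bigr => i _; rewrite weightE. Qed.

Lemma value_shift a w k j : value (weight_shift a w) k j = value w k (- a + j).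
Proof.
rewrite /value; case: unliftP => [l _|_]; last exact: mass_shift.
congr (f _ _ _); apply: eq_bigr => i _.
by rewrite mass_shift weightE.
Qed.

Lemma value0 w j : value w ord0 j = mass w j.
Proof. by rewrite /value unlift_none. Qed.

Lemma value_lift w l j : value w (lift ord0 l) j = f (position_in w j) ord0 l.
Proof. by rewrite /value liftK. Qed.

Lemma sum_mass w : point_of w -> \sum_j mass w j = 1.
Proof.
case=> _ <- _; rewrite exchange_big pair_bigA /=.
by apply: eq_bigr => -[].
Qed.

(** The masses sum to 1, so the largest is at least their average [p%:R^-1]. *)
Lemma mass_ge w e j : point_of w ->
  (forall j', mass w j' <= mass w j + e) -> p%:R^-1 - e <= mass w j.
Proof.
move=> wK le; have p0 : 0 < p%:R :> R by rewrite ltr0n prime_gt0.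
rewrite lerBlDr -(ler_pM2l p0) mulfV ?lt0r_neq0 // -[X in X <= _](sum_mass wK).
apply: (le_trans (ler_sum _ (fun j' _ => le j'))).
by rewrite sumr_const card_Fp // mulr_natl.
Qed.

(* The points [f (position_in w j)] only depend continuously on [w] where no
   mass vanishes, so coordinates other than the mass are compared only when all
   masses exceed half of their common value [1/p]. *)
Definition threshold : R := (p%:R *+ 2)^-1.

Definition coordinate w : 'I_d.+1 :=
  if [exists j, mass w j < threshold] then ord0
  else [arg max_(k > ord0) spread (value w k)]%O.

Definition argmax w k : {set F} := [set j | [forall j', value w k j' <= value w k j]]%SET.

Definition label w : 'I_d.+1 * F :=
  (coordinate w, equivariant_choice (argmax w (coordinate w))).

Lemma coordinate_shift a w : coordinate (weight_shift a w) = coordinate w.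
Proof.
rewrite /coordinate.
have -> : [exists j, mass (weight_shift a w) j < threshold] =
          [exists j, mass w j < threshold].
  apply/existsP/existsP => -[j jP]; first by exists (- a + j); rewrite -mass_shift.
  by exists (a + j); rewrite mass_shift addKr.
case: ifP => // _; congr (Order.arg_max _ _ _); apply/funext => k.
rewrite /spread (reindex_inj (addrI a)) /=; apply: eq_bigr => j _.
rewrite (reindex_inj (addrI a)) /=; apply: eq_bigr => j' _.
by rewrite !value_shift !addKr.
Qed.

Lemma argmax_shift a w k :
  argmax (weight_shift a w) k = [set a + j | j in argmax w k]%SET.
Proof.
apply/setP => j; rewrite inE; apply/forallP/imsetP => [H|[i]].
  exists (- a + j); last by rewrite addNKr.
  rewrite inE; apply/forallP => j'; have := H (a + j').
  by rewrite !value_shift addKr.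
by rewrite inE => /forallP H -> j'; rewrite !value_shift addKr.
Qed.

Lemma argmax_neq0 w k : argmax w k != finset.set0.
Proof.
apply/set0Pn; exists [arg max_(j > 0) value w k j]%O.
by rewrite inE; apply/forallP => j; case: arg_maxP => // i _; apply.
Qed.

Lemma argmax_full w k : argmax w k = [set: F]%SET -> forall j j', value w k j = value w k j'.
Proof.
move=> E j j'; apply/eqP; rewrite eq_le.
have /setP := E => H; have := H j; have := H j'; rewrite !inE.
by move=> /forallP/(_ j) -> /forallP/(_ j') ->.
Qed.

Hypothesis no_coincidence : forall w, point_of w -> (forall j, 0 < mass w j) ->
  exists j j', f (position_in w j) != f (position_in w j').

Lemma threshold_gt0 : 0 < threshold.
Proof. by rewrite invr_gt0 pmulrn_lgt0 // ltr0n prime_gt0. Qed.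

Lemma invp : p%:R^-1 = threshold + threshold.
Proof.
have p0 : p%:R != 0 :> R by rewrite pnatr_eq0 -lt0n prime_gt0.
by rewrite /threshold -mulr_natr; field.
Qed.

Lemma spread_pos w : point_of w -> (forall j, 0 < mass w j) ->
  exists k, 0 < spread (value w k).
Proof.
move=> wK w0; have [j [j' ne]] := no_coincidence wK w0.
apply: contrapT => none; case/eqP: ne; apply/rowP => l.
rewrite -!value_lift; apply: spread_eq0; apply/eqP; rewrite eq_le spread_ge0 andbT.
by rewrite leNgt; apply/negP => lt; apply: none; exists (lift ord0 l).
Qed.

(** A full argmax makes the chosen coordinate constant in [j]. Equal masses would all be [p%:R^-1],
    above the threshold; and when no mass is below it, the maximal spread is positive by
    [no_coincidence]. *)
Lemma argmax_label w : point_of w -> argmax w (coordinate w) != [set: F]%SET.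
Proof.
move=> wK; apply/eqP => /argmax_full; rewrite /coordinate.
have th := threshold_gt0; case: ifPn => [/existsP[j lt]|/existsPn ge] E.
  have := @mass_ge w 0 j wK; rewrite invp subr0.
  have le j' : mass w j' <= mass w j + 0 by rewrite addr0 -!value0 (E j' j).
  by move=> /(_ le); lra.
have w0 j : 0 < mass w j by have := ge j; rewrite -leNgt; lra.
have [k] := spread_pos wK w0; apply/negP; rewrite -leNgt.
rewrite -(const_spread E); case: arg_maxP => // i _; exact.
Qed.

Lemma label_shift a w : point_of w -> label (weight_shift a w) = cell_shift a (label w).
Proof.
move=> wK; rewrite /label coordinate_shift argmax_shift equivariant_choice_shift //.
  exact: argmax_neq0.
exact: argmax_label.
Qed.

Lemma label_max w k j : label w = (k, j) -> coordinate w = k /\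
  forall j', value w k j' <= value w k j.
Proof.
case=> ck <-; split=> // j'; rewrite -ck.
have := equivariant_choice_in (argmax_neq0 w (coordinate w)).
by rewrite inE => /forallP.
Qed.

End Tverberg.

(** * Compactness of the space of chessboard points *)

Section ChessboardCompact.
Variables (R : realType) (p : nat) (X : finType) (I : eqType) (col : X -> I).
Local Notation F := 'F_p.
Local Notation V := 'rV[R]_#|{: X * F}|.
Local Notation point_of := (@chessboard_point R p X I col).
Implicit Types (w x : V).

Lemma weight_continuous (c : X * F) : continuous (fun w : V => weight w c).
Proof. exact: coord_continuous. Qed.

(** Compatibility of the support means that products of weights over incompatible pairs vanish,
    which is a closed condition. *)
Lemma closed_chessboard_point : closed [set w : V | point_of w].
Proof.
have -> : [set w : V | point_of w] =
   (\bigcap_(c in [set: X * F]) (fun w : V => weight w c) @^-1` [set y | 0 <= y])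
   `&` ((fun w : V => \sum_c weight w c) @^-1` [set 1])
   `&` \bigcap_(c in [set c : (X * F) * (X * F) | c.1 != c.2 /\ ~~ compatible col c.1 c.2])
     (fun w : V => weight w c.1 * weight w c.2) @^-1` [set 0].
  apply/seteqP; split=> [w [w0 w1 wc]|w [[w0 w1] wc]].
    split; first by split=> // c _; apply: w0.
    move=> [c c'] /= [cc' nc]; apply/eqP; rewrite mulf_eq0.
    apply: contraNT nc; rewrite negb_or => /andP[wc0 wc'0]; exact: wc.
  split=> //= [c|c c' wc0 wc'0 cc']; first exact: w0.
  apply: contrapT => /negP nc; have := wc (c, c') (conj cc' nc).
  by move=> /= /eqP; rewrite mulf_eq0 (negPf wc0) (negPf wc'0).
apply: closedI; first apply: closedI.
- apply: closed_bigI => c _; apply: preimage_closed; last exact: closed_ge.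
  by move=> w _; apply: weight_continuous.
- apply: preimage_closed; last exact: closed_eq.
  by move=> w _; apply: (@cvg_sum_fin _ _ (nbhs w)) => c; apply: weight_continuous.
- apply: closed_bigI => c _; apply: preimage_closed; last exact: closed_eq.
  by move=> w _; apply: (@cvgM _ _ (nbhs w)); apply: weight_continuous.
Qed.

Lemma compact_chessboard_point : compact [set w : V | point_of w].
Proof.
have cube : compact [set w : V | forall i, `[0 : R, 1]%classic (w ord0 i)].
  exact: (rV_compact (fun i => @segment_compact R 0 1)).
apply: (subclosed_compact closed_chessboard_point cube).
move=> w [w0 w1 _] i /=; rewrite in_itv /= -(enum_valK i).
rewrite -/(weight w _) w0 -w1 (bigD1 (enum_val i)) //= lerDl.
by apply: sumr_ge0.
Qed.

End ChessboardCompact.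

(** * Labels of small tuples *)

Section LabelProper.
Variables (R : realType) (p : nat) (p_prime : prime p) (d N m : nat).
Variables (v : 'I_N.+1 -> 'rV[R]_m) (f : 'rV[R]_m -> 'rV[R]_d).
Hypothesis f_cont : {within simplex v, continuous f}.
Variables (I : eqType) (col : 'I_N.+1 -> I).
Local Notation F := 'F_p.
Local Notation X := 'I_N.+1.
Local Notation V := 'rV[R]_#|{: X * F}|.
Local Notation point_of := (@chessboard_point R p X I col).
Local Notation pos := (position_in v).
Local Notation val := (value v f).
Local Notation thr := (threshold R p).
Implicit Types (w x : V) (j : F) (k : 'I_d.+1).

Lemma mass_continuous j : continuous (fun w : V => mass w j).
Proof. by move=> w; apply: (@cvg_sum_fin _ _ (nbhs w)) => i; apply: weight_continuous. Qed.

Lemma position_cvg w j : mass w j != 0 -> pos x j @[x --> w] --> pos w j.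
Proof.
move=> w0; apply: (@cvg_sum_fin _ _ (nbhs w)) => i; apply: cvgZr_tmp.
apply: (@cvgM _ _ (nbhs w)); first exact: weight_continuous.
by apply: cvgV => //; apply: mass_continuous.
Qed.

Lemma position_simplex w j : point_of w -> 0 < mass w j -> simplex v (pos w j).
Proof.
move=> [w0 _ _] wj; exists (fun i => weight w (i, j) / mass w j); split=> //.
- by move=> i; rewrite divr_ge0 // ltW.
- by move=> i; rewrite finset.in_setT.
- by rewrite -mulr_suml mulfV // lt0r_neq0.
Qed.

(** Continuity of [f] holds only within the simplex; positive masses at [w] stay positive nearby and
    keep the positions of chessboard points inside it. *)
Lemma near_value w (e : R) : point_of w -> (forall j, 0 < mass w j) -> 0 < e ->
  \forall x \near w, point_of x -> forall k j, `|val w k j - val x k j| < e.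
Proof.
move=> wK w0 e0.
suff H k j : \forall x \near w, point_of x -> `|val w k j - val x k j| < e.
  have : \forall x \near w, forall k j, point_of x -> `|val w k j - val x k j| < e.
    apply: (@filter_forall _ _ _ (nbhs w)) => k.
    by apply: (@filter_forall _ _ _ (nbhs w)) => j; apply: H.
  by apply: filterS => x xP xK k j; apply: xP.
rewrite /value; case: unliftP => [l _|_]; last first.
  have /cvgrPdist_lt/(_ e e0) := @mass_continuous j w.
  by apply: filterS.
have fc : f y ord0 l @[y --> within (simplex v) (nbhs (pos w j))]
    --> f (pos w j) ord0 l.
  apply: (@cvg_comp _ _ _ f (fun M => M ord0 l) _ (nbhs (f (pos w j)))).
    rewrite nbhs_subspace_in; first exact: f_cont.
    exact: position_simplex.
  exact: coord_continuous.
have /cvgrPdist_lt/(_ e e0) := fc; rewrite near_withinE => fe.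
have {}fe : \forall x \near w, simplex v (pos x j) ->
    `|f (pos w j) ord0 l - f (pos x j) ord0 l| < e.
  by apply: (position_cvg _ fe); rewrite lt0r_neq0.
have /cvgrPdist_lt/(_ _ (w0 j)) mj := @mass_continuous j w.
apply: filterS2 fe mj => x fe mj xK; apply: fe; apply: position_simplex => //.
by move: mj; rewrite ltr_distlC => /andP[]; lra.
Qed.

Lemma near_mass w (e : R) : 0 < e ->
  \forall x \near w, forall j, `|mass w j - mass x j| < e.
Proof.
move=> e0; apply: (@filter_forall _ _ _ (nbhs w)) => j.
by have /cvgrPdist_lt/(_ e e0) := @mass_continuous j w.
Qed.

Hypothesis no_coincidence : forall w, point_of w -> (forall j, 0 < mass w j) ->
  exists j j', f (pos w j) != f (pos w j').

(** If all [(k, j)] occurred near [w], each column would be maximal in coordinate [k] at a nearby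
    point, so that coordinate would be almost constant at [w]. With a small mass at [w], [k] is the
    mass, and masses cannot be almost equal; otherwise [k] almost maximizes the spread, which is
    positive. *)
Lemma nondeficient_limit w : point_of w ->
  exists2 U : set V, nbhs w U &
  forall k (x : F -> V), (forall j, point_of (x j)) -> (forall j, U (x j)) ->
    ~ (forall j, (label v f (x j)) = (k, j)).
Proof.
move=> wK; have t0 := threshold_gt0 R p_prime; have tp := invp R p_prime.
have [/existsP[j lt]|/existsPn ge] := boolP [exists j, mass w j < thr].
  (* The first bound forces [mass w j] to be at least 1/p - [thr] = [thr]; the second keeps the mass
     of column [j] below the threshold near [w], so that labels there use [ord0]. *)
  pose e := Num.min (thr / 2) (thr - mass w j).
  have e0 : 0 < e by rewrite lt_min divr_gt0 //= subr_gt0.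
  exists [set x | forall j, `|mass w j - mass x j| < e]; first exact: near_mass.
  move=> k x xK xU xlab.
  have k0 : k = ord0.
    have [<- _] := label_max (xlab 0); rewrite /coordinate.
    rewrite (_ : [exists j, _]) //; apply/existsP; exists j.
    have := xU 0 j; rewrite ltr_distlC => /andP[_ h].
    have : e <= thr - mass w j by rewrite ge_min lexx orbT.
    by lra.
  have e2 : e <= thr / 2 by rewrite ge_min lexx.
  have := @mass_ge R p p_prime N I col w thr j wK.
  have le j' : mass w j' <= mass w j + thr.
    have [_ /(_ j')] := label_max (xlab j); rewrite k0 !value0 => h.
    have := xU j j; have := xU j j'; rewrite !ltr_distlC => /andP[h1 h2] /andP[h3 h4].
    by lra.
  by move=> /(_ le); rewrite tp; lra.
have w0 j : 0 < mass w j by have := ge j; rewrite -leNgt; lra.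
have [k kpos] := spread_pos no_coincidence wK w0.
pose P : R := #|F|%:R ^+ 2.
have P0 : 0 < P by rewrite exprn_gt0 // ltr0n; apply/card_gt0P; exists 0.
(* The first bound keeps almost equal masses above the threshold near [w]. For the second, three
   comparisons of spreads cost [2 * e * P] each, together less than [8 * e * P]. *)
pose e := Num.min (thr / 4) (spread (val w k) / (8 * P)).
have e0 : 0 < e by rewrite lt_min !divr_gt0 // mulr_gt0.
exists [set x | point_of x -> forall k j, `|val w k j - val x k j| < e].
  exact: near_value.
move=> l x xK xU xlab.
have near_const j j' : `|val w l j - val w l j'| <= 2 * e.
  have [_ /(_ j')] := label_max (xlab j); have [_ /(_ j)] := label_max (xlab j').
  have := xU j (xK j) l j; have := xU j (xK j) l j'.
  have := xU j' (xK j') l j; have := xU j' (xK j') l j'.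
  rewrite !ltr_distlC ler_norml.
  move=> /andP[? ?] /andP[? ?] /andP[? ?] /andP[? ?] ? ?.
  by apply/andP; split; lra.
have e4 : e <= thr / 4 by rewrite ge_min lexx.
have [lE _] := label_max (xlab 0); move: lE; rewrite /coordinate.
case: ifPn => [/existsP[j lt] l0|_ lE].
  have := @mass_ge R p p_prime N I col w (2 * e) j wK.
  have le j' : mass w j' <= mass w j + 2 * e.
    have := near_const j' j; rewrite -l0 !value0 ler_norml => /andP[? ?].
    by lra.
  move=> /(_ le); rewrite tp.
  have := xU 0 (xK 0) ord0 j; rewrite !value0 ltr_distlC => /andP[? ?].
  by lra.
have le_x : spread (val (x 0) k) <= spread (val (x 0) l).
  by rewrite -lE; case: arg_maxP => // i _; apply.
have close k2 j j' : `|val w k2 j - val w k2 j'| <= `|val (x 0) k2 j - val (x 0) k2 j'| + 2 * e.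
  have := xU 0 (xK 0) k2 j; have := xU 0 (xK 0) k2 j'.
  set a := val w k2 j; set b := val w k2 j'; set a' := val _ _ j; set b' := val _ _ j'.
  move=> hb ha; have -> : a - b = (a' - b') + ((a - a') - (b - b')) by ring.
  apply: (le_trans (ler_normD _ _)); rewrite lerD2l.
  apply: (le_trans (ler_normB _ _)); lra.
have close' k2 j j' : `|val (x 0) k2 j - val (x 0) k2 j'| <= `|val w k2 j - val w k2 j'| + 2 * e.
  have := xU 0 (xK 0) k2 j; have := xU 0 (xK 0) k2 j'.
  set a := val w k2 j; set b := val w k2 j'; set a' := val _ _ j; set b' := val _ _ j'.
  move=> hb ha; have -> : a' - b' = (a - b) + ((b - b') - (a - a')) by ring.
  apply: (le_trans (ler_normD _ _)); rewrite lerD2l.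
  apply: (le_trans (ler_normB _ _)); lra.
have h1 := spread_le (close k); have h2 := spread_le (close' l).
have h3 : spread (val w l) <= spread ((fun=> 0) : F -> R) + 2 * e * P.
  by rewrite /P; apply: spread_le => j j'; rewrite subrr normr0 add0r near_const.
have h4 : e * (8 * P) <= spread (val w k).
  have P8 : 0 < 8 * P by rewrite mulr_gt0.
  by rewrite -(ler_pdivlMr _ _ P8) ge_min lexx orbT.
have h5 : spread ((fun=> 0) : F -> R) = 0 by apply: const_spread.
have h6 : 0 < e * P by rewrite mulr_gt0.
move: h1 h2; rewrite -/P; lra.
Qed.

(** A Lebesgue number argument: counterexamples of diameter tending to 0 would accumulate at a
    chessboard point, against [nondeficient_limit]. *)
Lemma small_tuples_deficient : exists2 e : R, 0 < e &
  forall u : seq V, (forall w, w \in u -> point_of w) ->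
    (forall w w', w \in u -> w' \in u -> `|w - w'| < e) ->
    deficient (map (label v f) u).
Proof.
apply: contrapT => none.
have {}none n : exists kx : 'I_d.+1 * (F -> V),
    [/\ forall j, point_of (kx.2 j), forall j j', `|kx.2 j - kx.2 j'| < n.+1%:R^-1 &
       forall j, label v f (kx.2 j) = (kx.1, j)].
  apply: contrapT => no; apply: none; exists n.+1%:R^-1; first by rewrite invr_gt0 ltr0n.
  move=> u uK ud; apply/forallP => k; apply/existsP.
  apply: contrapT => nj; apply: no.
  have /choice[x xP] j : exists w, w \in u /\ label v f w = (k, j).
    have : (k, j) \in map (label v f) u.
      by apply: contrapT => /negP h; apply: nj; exists j.
    by move=> /mapP[w wu ->]; exists w.
  exists (k, x); split=> /= [j|j j'|j].
  - by apply: uK; case: (xP j).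
  - by apply: ud; [case: (xP j)|case: (xP j')].
  - by case: (xP j).
have /choice[kx kxP] := none.
(* Following the points of column 0 is enough: the other columns stay within [n.+1%:R^-1] of
   them. *)
have [w [wK wcl]] : [set w | point_of w] `&` cluster ((fun n => (kx n).2 0) @ \oo) !=set0.
  apply: compact_chessboard_point; exists 0%N => // n _ /=.
  by case: (kxP n).
have [U /nbhs_normP[e e0 eU] bad] := nondeficient_limit wK.
have e20 : 0 < e / 2 by rewrite divr_gt0.
have [n0 _ n0P] : \forall n \near \oo, n.+1%:R^-1 < e / 2.
  have := @cvg_harmonic R => /cvgrPdist_lt/(_ _ e20) [n0 _ n0P].
  exists n0 => // n /n0P /=; rewrite sub0r normrN; apply: le_lt_trans.
  exact: ler_norm.
have [|x [[n nn0 <-] xw]] := wcl [set (kx n).2 0 | n in [set n | (n0 <= n)%N]]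
    (ball w (e / 2)) _ (nbhsx_ballx _ _ e20).
  by exists n0 => // n /= h; exists n.
have [xK xd xl] := kxP n.
apply: (bad _ (kx n).2 xK) xl => j; apply: eU => /=.
rewrite -[w](subrK ((kx n).2 0)) -addrA.
apply: (le_lt_trans (ler_normD _ _)); rewrite (splitr e).
apply: ltrD; first by move: xw; rewrite -ball_normE.
by apply: lt_trans (xd _ _) _; apply: n0P.
Qed.

End LabelProper.

(** * From a coincidence to the faces *)

Section Faces.
Variables (R : realType) (r : nat) (r_prime : prime r) (d N m : nat).
Variables (v : 'I_N.+1 -> 'rV[R]_m) (f : 'rV[R]_m -> 'rV[R]_d).
Variables (I : finType) (C : I -> {set 'I_N.+1}) (col : 'I_N.+1 -> I).
Hypothesis colP : forall x i, x \in C i -> col x = i.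
Local Notation F := 'F_r.
Local Notation V := 'rV[R]_#|{: 'I_N.+1 * F}|.

Lemma coincidence_faces (w : V) : chessboard_point col w ->
  (forall j, 0 < mass w j) ->
  (forall j j', f (position_in v w j) = f (position_in v w j')) ->
  exists F : 'I_r -> {set 'I_N.+1},
    [/\ forall j k : 'I_r, j != k -> (F j :&: F k)%SET = finset.set0,
        forall i (j : 'I_r), (#|(C i :&: F j)%SET| <= 1)%N &
        \bigcap_(j in [set: 'I_r]) (f @` face v (F j)) !=set0].
Proof.
move=> [w0 w1 wc] mpos fE.
(* The face of index [j] is the support of column [j]. A vertex in two columns, or two vertices of
   one part in the same column, would be incompatible. *)
exists (fun j : 'I_r => [set x | weight w (x, (j : nat)%:R) != 0]%SET); split.
- move=> j k jk; apply/setP => x; rewrite !finset.inE; apply/negP => /andP[xj xk].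
  have neq : (x, (j : nat)%:R) != (x, (k : nat)%:R) :> 'I_N.+1 * F.
    rewrite xpair_eqE eqxx /=; apply: contra jk => /eqP/(congr1 \val).
    by rewrite /= !val_Fp_nat // !modn_small // => /val_inj ->.
  by have := wc _ _ xj xk neq; rewrite /compatible eqxx.
- move=> i j; apply/card_le1_eqP => x y; rewrite !finset.inE.
  move=> /andP[xC xj] /andP[yC yj]; apply/eqP; apply: contraT => xy.
  have neq : (x, (j : nat)%:R) != (y, (j : nat)%:R) :> 'I_N.+1 * F.
    by rewrite xpair_eqE negb_and eq_sym xy.
  have := wc _ _ xj yj neq.
  by rewrite /compatible /= (colP xC) (colP yC) !eqxx andbF.
exists (f (position_in v w 0)) => j _; exists (position_in v w (j : nat)%:R) => //.
exists (fun x => weight w (x, (j : nat)%:R) / mass w (j : nat)%:R); split=> //.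
- by move=> x; apply: divr_ge0; [apply: w0 | apply: ltW].
- by move=> x; rewrite finset.inE negbK => /eqP->; rewrite mul0r.
- by rewrite -mulr_suml -/(mass w _) mulfV ?lt0r_neq0.
Qed.

End Faces.

Theorem theorem2p2 (R : realType) (r d N m : nat)
  (r_prime : prime r) (d_ge1 : (1 <= d)%N) (NE : N = ((r - 1) * (d + 1))%N)
  (v : 'I_N.+1 -> 'rV[R]_m) (v_indep : affinely_independent v)
  (C : 'I_d.+2 -> {set 'I_N.+1})
  (C_cover : forall x : 'I_N.+1, exists i : 'I_d.+2, x \in C i)
  (C_disj : forall i j : 'I_d.+2, i != j -> (C i :&: C j)%SET = finset.set0)
  (C_card : forall i : 'I_d.+2, (i <= d)%N -> #|C i| = (r - 1)%N)
  (C_card_last : #|C ord_max| = 1%N)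
  (f : 'rV[R]_m -> 'rV[R]_d) (f_cont : {within simplex v, continuous f}) :
  exists F : 'I_r -> {set 'I_N.+1},
    [/\ forall j k : 'I_r, j != k -> (F j :&: F k)%SET = finset.set0,
        forall (i : 'I_d.+2) (j : 'I_r), (#|(C i :&: F j)%SET| <= 1)%N &
        \bigcap_(j in [set: 'I_r]) (f @` face v (F j)) !=set0].
Proof.
have /choice[col colC] := C_cover.
have colP x i : x \in C i -> col x = i.
  move=> xi; apply/eqP; apply: contraT => /C_disj/setP/(_ x).
  by rewrite !finset.inE colC xi.
have unrel i j : i != j -> differently_colored col (C i) (C j).
  by move=> ij; apply/forall_inP => x xi; apply/forall_inP => y yj; rewrite (colP x i) ?(colP y j).
apply: contrapT => noF.
have no_coincidence (w : 'rV[R]_#|{: 'I_N.+1 * 'F_r}|) : chessboard_point col w ->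
    (forall j, 0 < mass w j) ->
    exists j j', f (position_in v w j) != f (position_in v w j').
  move=> wK mpos; apply: contrapT => no; apply: noF.
  apply: (coincidence_faces r_prime colP wK mpos) => j j'.
  by apply/eqP; apply: contrapT => /negP ne; apply: no; exists j, j'.
have [e e0 small] := small_tuples_deficient r_prime f_cont no_coincidence.
have /cards1P[v0 v0E] : #|C ord_max| == 1%N by rewrite C_card_last.
have label_equiv := label_shift r_prime no_coincidence.
(* The first d + 1 parts, of size r - 1, give the chessboards; the vertex [v0] of the last part is
   the apex of the cone. *)
pose Cs := [seq C (widen_ord (leqnSn d.+1) k) | k <- enum 'I_d.+1].
have [||||u [uK ud]] := small_nondeficient_tuple r_prime (Cs := Cs) (v := v0) e0 label_equiv.
- by rewrite size_map cardE.
- apply/allP => _ /mapP[k _ ->]; rewrite C_card ?subn1 //=.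
  by rewrite -ltnS.
- rewrite pairwise_map; apply: (@sub_in_pairwise _ predT [rel x y | x != y]).
  + by move=> i j _ _ /= ij; apply: unrel.
  + by apply/allP.
  + by rewrite -uniq_pairwise enum_uniq.
- rewrite -v0E; apply/allP => _ /mapP[k _ ->]; apply: unrel.
  by rewrite -val_eqE /= neq_ltn ltn_ord orbT.
by move=> /negP; apply; apply: small.
Qed.
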